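(* Let $\boldsymbol{\varrho}=\boldsymbol{\varrho}(u)$, $u\in(a,b)$, be a smooth regular unit speed curve of finite length, topologically imbedded in $\mathbb{E}^{3}$, with nowhere vanishing curvature $\kappa$, torsion $\tau$ and Frenet frame $\{\boldsymbol{t},\boldsymbol{h},\boldsymbol{b}\}$. Let $r$ be a real number with $0<r<\min\frac{1}{|\kappa|}$ such that the tube $T_{r}(\boldsymbol{\varrho})$ of radius $r$ about $\boldsymbol{\varrho}$, parametrized by $$\boldsymbol{x}(u,\varphi)=\boldsymbol{\varrho}(u)+r\cos\varphi\,\boldsymbol{h}(u)+r\sin\varphi\,\boldsymbol{b}(u),$$ is a smooth surface in $\mathbb{E}^{3}$. Then for every nonempty open part $M^{2}$ of this tube which contains no parabolic points (that is, on which $\cos\varphi\neq 0$), the Gauss map $$\boldsymbol{n}(u,\varphi)=-\cos\varphi\,\boldsymbol{h}(u)-\sin\varphi\,\boldsymbol{b}(u)$$ of $M^{2}$ is of infinite type corresponding to the second fundamental form $II$, i.e. it is not of finite $II$-type.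
   Context: $\mathbb{E}^{3}$ is Euclidean 3-space. For a unit speed curve, $\boldsymbol{t},\boldsymbol{h},\boldsymbol{b}$ denote the unit tangent, principal normal and binormal vector fields. The tube of radius $r$ about $\boldsymbol{\varrho}$ is the set of points $\boldsymbol{\varrho}(u)+\boldsymbol{w}$ with $u\in(a,b)$, $\boldsymbol{w}$ normal to $\boldsymbol{\varrho}$ at $\boldsymbol{\varrho}(u)$ and $\|\boldsymbol{w}\|=r$ ($r>0$ sufficiently small). Its Gauss curvature is $K=-\frac{\kappa\cos\varphi}{r\delta}$ with $\delta=1-r\kappa\cos\varphi$. A point of a surface is treated as parabolic when $K=0$ there; all surfaces are assumed to contain no parabolic points, so that the second fundamental form is nondegenerate. Let $M^{2}$ be a surface in $\mathbb{E}^{3}$ without parabolic points, parametrized by $\boldsymbol{x}(u^{1},u^{2})$, with second fundamental form $II=b_{ij}\,du^{i}du^{j}$, inverse tensor $(b^{ij})$ and $b=\det(b_{ij})$. The second Beltrami differential operator with respect to $II$ is $$\Delta^{II}f=-\frac{1}{\sqrt{|b|}}\frac{\partial}{\partial u^{j}}\left(\sqrt{|b|}\,b^{ij}\frac{\partial f}{\partial u^{i}}\right)$$ for sufficiently differentiable functions $f$ on $M^{2}$, and it acts on vector-valued maps componentwise (in a fixed Cartesian coordinate system of $\mathbb{E}^{3}$). The Gauss map $\boldsymbol{n}$ (unit normal vector field, regarded as a map $M^{2}\to\mathbb{E}^{3}$) is said to be of finite $II$-type if it can be written as a finite sum $$\boldsymbol{n}=\boldsymbol{n}_{0}+\sum_{i=1}^{k}\boldsymbol{n}_{i},\qquad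 \Delta^{II}\boldsymbol{n}_{i}=\lambda_{i}\boldsymbol{n}_{i},\quad i=1,\dots,k,$$ where $\boldsymbol{n}_{0}$ is a fixed vector, $\boldsymbol{n}_{1},\dots,\boldsymbol{n}_{k}$ are nonconstant smooth $\mathbb{E}^{3}$-valued maps on $M^{2}$, and $\lambda_{1},\dots,\lambda_{k}$ are real constants. Otherwise it is said to be of infinite $II$-type (of infinite type corresponding to the second fundamental form). *)

(* Defs.v *)
From Stdlib Require Import Reals.
From Coquelicot Require Import Coquelicot.
Open Scope R_scope.

Definition E3 : Type := (R * R * R)%type.

Definition px (p : E3) : R := fst (fst p).
Definition py (p : E3) : R := snd (fst p).
Definition pz (p : E3) : R := snd p.

Definition dot (p q : E3) : R := px p * px q + py p * py q + pz p * pz q.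

Definition enorm (p : E3) : R := sqrt (dot p p).

Definition cross (p q : E3) : E3 :=
  (py p * pz q - pz p * py q,
   pz p * px q - px p * pz q,
   px p * py q - py p * px q).

(** The last clause is continuity of the inverse map from [f(D)] to [D]. *)
Definition top_embedding_on {T S : UniformSpace} (D : T -> Prop) (f : T -> S)
  : Prop :=
  (forall s t, D s -> D t -> f s = f t -> s = t) /\
  (forall t, D t -> filterlim f (within D (locally t)) (locally (f t))) /\
  (forall t, D t -> forall P : T -> Prop, locally t P ->
     locally (f t) (fun q => forall s, D s -> f s = q -> P s)).

Definition smooth_curve_on (a b : R) (c : R -> E3) : Prop :=
  forall (n : nat) (u : R), a < u < b ->
    ex_derive_n (fun s => px (c s)) n u /\
    ex_derive_n (fun s => py (c s)) n u /\
    ex_derive_n (fun s => pz (c s)) n u.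

(** For open [U], [ex_diff_n f n] at all points of [U] says that [f] is of
    class C^n on [U]. *)
Definition smooth_map_on (U : R * R -> Prop) (F : R -> R -> E3) : Prop :=
  forall (n : nat) (u v : R), U (u, v) ->
    ex_diff_n (fun s t => px (F s t)) n u v /\
    ex_diff_n (fun s t => py (F s t)) n u v /\
    ex_diff_n (fun s t => pz (F s t)) n u v.

Definition d1 (f : R -> R -> R) (u v : R) : R := Derive (fun s => f s v) u.
Definition d2 (f : R -> R -> R) (u v : R) : R := Derive (fun t => f u t) v.

Definition componentwise (L : (R -> R -> R) -> R -> R -> R)
  (F : R -> R -> E3) (u v : R) : E3 :=
  (L (fun s t => px (F s t)) u v,
   L (fun s t => py (F s t)) u v,
   L (fun s t => pz (F s t)) u v).

Definition D1 : (R -> R -> E3) -> R -> R -> E3 := componentwise d1.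
Definition D2 : (R -> R -> E3) -> R -> R -> E3 := componentwise d2.

Definition smooth_surface (S : E3 -> Prop) : Prop :=
  forall p, S p ->
  exists (V : E3 -> Prop) (U : R * R -> Prop) (y : R -> R -> E3),
    open V /\ V p /\ open U /\
    smooth_map_on U y /\
    (forall u v, U (u, v) -> cross (D1 y u v) (D2 y u v) <> (0, 0, 0)) /\
    top_embedding_on U (fun w : R * R => y (fst w) (snd w)) /\
    (forall q, V q /\ S q <-> exists u v, U (u, v) /\ y u v = q).

Definition open_part_of (S M : E3 -> Prop) : Prop :=
  exists O : E3 -> Prop, open O /\ forall p, M p <-> O p /\ S p.

(** [x] is a parametrization of a surface and [n] its unit normal field. *)
Section Surface.

Variables x n : R -> R -> E3.

Definition g11 (u v : R) : R := dot (D1 x u v) (D1 x u v).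
Definition g12 (u v : R) : R := dot (D1 x u v) (D2 x u v).
Definition g22 (u v : R) : R := dot (D2 x u v) (D2 x u v).

Definition b11 (u v : R) : R := dot (D1 (D1 x) u v) (n u v).
Definition b12 (u v : R) : R := dot (D2 (D1 x) u v) (n u v).
Definition b22 (u v : R) : R := dot (D2 (D2 x) u v) (n u v).

Definition detII (u v : R) : R := b11 u v * b22 u v - b12 u v ^ 2.

Definition gauss_curvature (u v : R) : R :=
  detII u v / (g11 u v * g22 u v - g12 u v ^ 2).

Definition parabolic (u v : R) : Prop := gauss_curvature u v = 0.

Definition ib11 (u v : R) : R := b22 u v / detII u v.
Definition ib12 (u v : R) : R := - b12 u v / detII u v.
Definition ib22 (u v : R) : R := b11 u v / detII u v.

Definition wII (u v : R) : R := sqrt (Rabs (detII u v)).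

Definition DeltaII (f : R -> R -> R) (u v : R) : R :=
  - / wII u v *
  (d1 (fun s t => wII s t * (ib11 s t * d1 f s t + ib12 s t * d2 f s t)) u v +
   d2 (fun s t => wII s t * (ib12 s t * d1 f s t + ib22 s t * d2 f s t)) u v).

(** [M] is the image under [x] of the parameter domain [U]. A map [f] on [M] is
    represented by a map on E^3 whose values outside [M] are irrelevant; its
    smoothness and its Laplacian are those of [f] expressed in the parameters,
    i.e. of [f o x] on [U]. *)
Definition finite_II_type (U : R * R -> Prop) (M : E3 -> Prop) : Prop :=
  exists (n0 : E3) (k : nat) (nn : nat -> E3 -> E3) (lambda : nat -> R),
    (forall i, (1 <= i <= k)%nat ->
       (exists p q, M p /\ M q /\ nn i p <> nn i q) /\
       smooth_map_on U (fun u v => nn i (x u v)) /\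
       (forall u v, U (u, v) ->
          componentwise DeltaII (fun s t => nn i (x s t)) u v =
          scal (lambda i) (nn i (x u v)))) /\
    (forall u v, U (u, v) ->
       n u v = plus n0 (sum_n_m (fun i => nn i (x u v)) 1 k)).

Definition infinite_II_type (U : R * R -> Prop) (M : E3 -> Prop) : Prop :=
  ~ finite_II_type U M.

End Surface.

Definition Dcurve (c : R -> E3) (u : R) : E3 :=
  (Derive (fun s => px (c s)) u,
   Derive (fun s => py (c s)) u,
   Derive (fun s => pz (c s)) u).

Definition tangent (rho : R -> E3) : R -> E3 := Dcurve rho.

Definition curvature (rho : R -> E3) (u : R) : R :=
  enorm (Dcurve (tangent rho) u).

Definition pnormal (rho : R -> E3) (u : R) : E3 :=
  scal (/ curvature rho u) (Dcurve (tangent rho) u).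

Definition binormal (rho : R -> E3) (u : R) : E3 :=
  cross (tangent rho u) (pnormal rho u).

Definition tube (rho : R -> E3) (a b r : R) (p : E3) : Prop :=
  exists (u : R) (w : E3),
    a < u < b /\ dot w (tangent rho u) = 0 /\ enorm w = r /\
    p = plus (rho u) w.

Definition tube_param (rho : R -> E3) (r : R) (u phi : R) : E3 :=
  plus (rho u)
    (plus (scal (r * cos phi) (pnormal rho u))
          (scal (r * sin phi) (binormal rho u))).

Definition tube_gauss_map (rho : R -> E3) (u phi : R) : E3 :=
  plus (scal (- cos phi) (pnormal rho u)) (scal (- sin phi) (binormal rho u)).

(** Parameter domain of a part [M] of the tube: [u] in (a,b), [phi] any real. *)
Definition tube_domain (rho : R -> E3) (a b r : R) (M : E3 -> Prop)
  (w : R * R) : Prop :=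
  a < fst w < b /\ M (tube_param rho r (fst w) (snd w)).

(* Main.v *)
Require Import Defs.
From Stdlib Require Import Reals Lra Lia List Classical.
From Coquelicot Require Import Coquelicot.
Open Scope R_scope.

(** Write kappa, tau for curvature and torsion, c = cos phi, and
    beta = kappa (1 - r kappa c) c. The Frenet equations give
    b11 = r tau^2 - beta, b12 = r tau, b22 = r, so det II = - r beta. With
    D = d/du - tau d/dphi and E = D f the Laplacian of a function f is

      (D E) / beta - (D beta) E / (2 beta^2)
        - (1/r) (f_phiphi + beta_phi f_phi / (2 beta)).

    It is singular on the parallels c = 0, and it raises the order of a pole
    there. Call a function regular if it is built by sums and products from
    smooth functions of u, cos, sin and 1 / (1 - r kappa c); such a function
    is smooth on the whole strip a < u < b, including c = 0. If F is regular
    and p > 0, the Laplacian of F / c^p has the form G / c^(p+3) with G regular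
    and G = (tau^2 / kappa) p (p + 3/2) F where c = 0 ([is_lap_twist]). If tau
    vanishes identically, it has the form G / c^(p+2) with G regular and
    G = (-1/r) p (p + 1/2) F where c = 0 ([is_lap_untwisted]).

    Moreover D n = kappa c t, and from this the Laplacian of n is F / c with
    F = (tau sin phi t + h / r) / 2 where c = 0 ([is_lap_gauss]). This vector
    is never 0, because its component along h is 1 / (2 r).

    If n = n0 + n_1 + ... + n_k with eigenmaps n_i, the Laplacian of n is
    lambda_1 n_1 + ... + lambda_k n_k, a sum of eigenfunctions with a pole of
    order one. Subtracting lambda_k f from the Laplacian of f removes the k-th
    eigenfunction from such a sum f and keeps a pole, since the Laplacian has
    strictly larger pole order than f. After k steps the zero function would
    have a pole ([pole_at_not_eigensum]).

    The part M may stay away from the parallels c = 0, so the vanishing of a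
    regular function on M has to be transported to them. For fixed u put
    phi = phi0 + 2 atan q: every regular function becomes a quotient of
    polynomials in q whose denominator has no real zero, hence if it vanishes
    for phi near phi0 it vanishes for all q ([regular_continuation]), and one
    value of q gives c = 0 ([cos_zero_reached]). *)

(** * Derivatives and smooth functions of one variable *)

(** The rules below fix the field to be R and give derivatives in terms of the
    real operations, so that the tactic [der] can differentiate by unification
    and leave an equation for [ring] or [field]. *)
Lemma der_eq (f : R -> R) (x l l' : R) : is_derive f x l -> l = l' -> is_derive f x l'.
Proof. now intros H <-. Qed.

Lemma der_plus (f g : R -> R) (x l m : R) :
  is_derive f x l -> is_derive g x m -> is_derive (fun y => f y + g y) x (l + m).
Proof. intros Hf Hg; exact (is_derive_plus f g x l m Hf Hg). Qed.

Lemma der_minus (f g : R -> R) (x l m : R) :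
  is_derive f x l -> is_derive g x m -> is_derive (fun y => f y - g y) x (l - m).
Proof. intros Hf Hg; exact (is_derive_minus f g x l m Hf Hg). Qed.

Lemma der_opp (f : R -> R) (x l : R) :
  is_derive f x l -> is_derive (fun y => - f y) x (- l).
Proof. intros Hf; exact (is_derive_opp f x l Hf). Qed.

Lemma der_mult (f g : R -> R) (x l m : R) :
  is_derive f x l -> is_derive g x m ->
  is_derive (fun y => f y * g y) x (l * g x + f x * m).
Proof. intros Hf Hg; exact (is_derive_mult f g x l m Hf Hg Rmult_comm). Qed.

Lemma der_const (c x : R) : is_derive (fun _ : R => c) x 0.
Proof. exact (is_derive_const c x). Qed.

Lemma der_id (x : R) : is_derive (fun y : R => y) x 1.
Proof. exact (is_derive_id x). Qed.

Lemma der_inv (f : R -> R) (x l : R) :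
  is_derive f x l -> f x <> 0 -> is_derive (fun y => / f y) x (- l / f x ^ 2).
Proof. exact (is_derive_inv f x l). Qed.

Lemma der_cos (x : R) : is_derive cos x (- sin x).
Proof. apply is_derive_Reals, derivable_pt_lim_cos. Qed.

Lemma der_sin (x : R) : is_derive sin x (cos x).
Proof. apply is_derive_Reals, derivable_pt_lim_sin. Qed.

(* Dispatch is syntactic: unifying an arbitrary function with [cos] would unfold it. *)
Ltac der1 :=
  lazymatch goal with
  | |- is_derive (fun _ => ?c) _ _ => apply der_const
  | |- is_derive (fun y => y) _ _ => apply der_id
  | |- is_derive cos _ _ => apply der_cos
  | |- is_derive (fun y => cos y) _ _ => apply der_cos
  | |- is_derive sin _ _ => apply der_sin
  | |- is_derive (fun y => sin y) _ _ => apply der_sin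
  | |- is_derive (fun y => @?f y + @?g y) _ _ => apply (der_plus f g)
  | |- is_derive (fun y => @?f y - @?g y) _ _ => apply (der_minus f g)
  | |- is_derive (fun y => - @?f y) _ _ => apply (der_opp f)
  | |- is_derive (fun y => @?f y * @?g y) _ _ => apply (der_mult f g)
  | |- _ => eassumption
  end.

Ltac der := eapply der_eq; [ repeat der1 | cbv beta ].

(** The derivatives are given by a chain of functions rather than by
    [Derive], so that closure under sums, products, inverses and square roots
    is a direct induction on the order. *)
Fixpoint Ck (a b : R) (n : nat) (g : R -> R) : Prop :=
  match n with
  | O => True
  | S m => exists g', (forall u, a < u < b -> is_derive g u (g' u)) /\ Ck a b m g'
  end.

Definition smooth (a b : R) (g : R -> R) : Prop := forall n, Ck a b n g.

Lemma between_locally a b u : a < u < b -> locally u (fun s => a < s < b).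
Proof.
  intros Hu; apply (locally_interval _ u a b); simpl; tauto.
Qed.

Section Smooth.
Context (a b : R).
Notation Ck := (Ck a b).
Notation smooth := (smooth a b).

Lemma Ck_ext n f g : (forall u, a < u < b -> f u = g u) -> Ck n f -> Ck n g.
Proof.
  destruct n as [|n]; [easy|]; intros E [f' [Hf Hk]].
  exists f'; split; [|exact Hk]; intros u Hu.
  apply (is_derive_ext_loc f); [|now apply Hf].
  generalize (between_locally a b u Hu); apply filter_imp; exact E.
Qed.

Lemma Ck_S n f : Ck (S n) f -> Ck n f.
Proof.
  revert f; induction n as [|n IH]; [easy|]; intros f [f' [Hf Hk]].
  exists f'; split; [exact Hf|]; now apply IH.
Qed.

Lemma Ck_const n c : Ck n (fun _ => c).
Proof.
  revert c; induction n as [|n IH]; intros c; [easy|].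
  exists (fun _ => 0); split; [intros; apply der_const | apply IH].
Qed.

Lemma Ck_plus n f g : Ck n f -> Ck n g -> Ck n (fun u => f u + g u).
Proof.
  revert f g; induction n as [|n IH]; [easy|].
  intros f g [f' [Hf Kf]] [g' [Hg Kg]].
  exists (fun u => f' u + g' u); split; [|now apply IH].
  intros u Hu; apply der_plus; auto.
Qed.

Lemma Ck_mult n f g : Ck n f -> Ck n g -> Ck n (fun u => f u * g u).
Proof.
  revert f g; induction n as [|n IH]; [easy|].
  intros f g Kf Kg.
  pose proof (Ck_S _ _ Kf) as Lf; pose proof (Ck_S _ _ Kg) as Lg.
  destruct Kf as [f' [Hf Kf]]; destruct Kg as [g' [Hg Kg]].
  exists (fun u => f' u * g u + f u * g' u); split.
  - intros u Hu; apply der_mult; auto.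
  - apply Ck_plus; apply IH; assumption.
Qed.

(** The derivative of 1/f contains 1/f again, but one order lower. The same
    device works for square roots. *)
Lemma Ck_inv n f : (forall u, a < u < b -> f u <> 0) -> Ck n f -> Ck n (fun u => / f u).
Proof.
  intros Hn; induction n as [|n IH]; [easy|]; intros Kf.
  pose proof (IH (Ck_S _ _ Kf)) as Li; destruct Kf as [f' [Hf Kf]].
  exists (fun u => (-1 * f' u) * (/ f u * / f u)); split.
  - intros u Hu; eapply der_eq; [apply der_inv; [apply Hf|]; auto|].
    simpl; field; auto.
  - apply Ck_mult; apply Ck_mult; auto using Ck_const.
Qed.

Lemma Ck_sqrt n f : (forall u, a < u < b -> 0 < f u) -> Ck n f -> Ck n (fun u => sqrt (f u)).
Proof.
  intros Hn; induction n as [|n IH]; [easy|]; intros Kf.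
  pose proof (IH (Ck_S _ _ Kf)) as Li; destruct Kf as [f' [Hf Kf]].
  exists (fun u => (f' u * / 2) * / sqrt (f u)); split.
  - intros u Hu; eapply der_eq; [apply is_derive_sqrt; [apply Hf|]; auto|].
    pose proof (sqrt_lt_R0 _ (Hn u Hu)); simpl; field; lra.
  - apply Ck_mult; [apply Ck_mult; auto using Ck_const|].
    apply Ck_inv; [|exact Li].
    intros u Hu; pose proof (sqrt_lt_R0 _ (Hn u Hu)); lra.
Qed.

Lemma smooth_ext f g : (forall u, a < u < b -> f u = g u) -> smooth f -> smooth g.
Proof. intros E Hf n; exact (Ck_ext n f g E (Hf n)). Qed.

Lemma smooth_const c : smooth (fun _ => c).
Proof. intros n; apply Ck_const. Qed.

Lemma smooth_plus f g : smooth f -> smooth g -> smooth (fun u => f u + g u).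
Proof. intros Hf Hg n; apply Ck_plus; auto. Qed.

Lemma smooth_mult f g : smooth f -> smooth g -> smooth (fun u => f u * g u).
Proof. intros Hf Hg n; apply Ck_mult; auto. Qed.

Lemma smooth_minus f g : smooth f -> smooth g -> smooth (fun u => f u - g u).
Proof.
  intros Hf Hg; apply (smooth_ext (fun u => f u + -1 * g u)); [intros; ring|].
  auto using smooth_plus, smooth_mult, smooth_const.
Qed.

Lemma smooth_inv f : (forall u, a < u < b -> f u <> 0) -> smooth f -> smooth (fun u => / f u).
Proof. intros Hn Hf n; apply Ck_inv; auto. Qed.

Lemma smooth_sqrt f : (forall u, a < u < b -> 0 < f u) -> smooth f -> smooth (fun u => sqrt (f u)).
Proof. intros Hn Hf n; apply Ck_sqrt; auto. Qed.

Lemma smooth_is_derive f u : smooth f -> a < u < b -> is_derive f u (Derive f u).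
Proof.
  intros Hf Hu; destruct (Hf 1%nat) as [f' [Hd _]].
  apply Derive_correct; exists (f' u); auto.
Qed.

Lemma smooth_Derive f : smooth f -> smooth (Derive f).
Proof.
  intros Hf n; destruct (Hf (S n)) as [f' [Hd Hk]].
  apply (Ck_ext n f'); [|exact Hk]; intros u Hu.
  symmetry; apply is_derive_unique; auto.
Qed.

Lemma smooth_of_ex_derive_n f :
  (forall n u, a < u < b -> ex_derive_n f n u) -> smooth f.
Proof.
  intros Hf n.
  assert (H : forall n m, Ck n (Derive_n f m)); [|exact (H n 0%nat)].
  clear n; induction n as [|n IH]; intros m; [easy|].
  exists (Derive_n f (S m)); split; [|apply IH].
  intros u Hu; apply Derive_correct; exact (Hf (S m) u Hu).
Qed.

End Smooth.

(** * Polynomials and the half-angle substitution *)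

Fixpoint horner (l : list R) (x : R) : R :=
  match l with nil => 0 | cons c l => c + x * horner l x end.

Definition polynomial (f : R -> R) : Prop := exists l, forall x, f x = horner l x.

Lemma polynomial_const c : polynomial (fun _ => c).
Proof. exists (c :: nil); intros; simpl; ring. Qed.

Lemma polynomial_id : polynomial (fun x => x).
Proof. exists (0 :: 1 :: nil); intros; simpl; ring. Qed.

Lemma polynomial_plus f g :
  polynomial f -> polynomial g -> polynomial (fun x => f x + g x).
Proof.
  intros [l Hl]; revert f Hl g; induction l as [|c l IH]; intros f Hf g [m Hm].
  - exists m; intros; rewrite Hf, Hm; simpl; ring.
  - destruct m as [|d m].
    + exists (c :: l); intros; rewrite Hf, Hm; simpl; ring.
    + destruct (IH (horner l) (fun _ => eq_refl) (horner m)) as [h Hh];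
        [now exists m|].
      exists (c + d :: h); intros; rewrite Hf, Hm; simpl; rewrite <- Hh; ring.
Qed.

Lemma polynomial_mult f g :
  polynomial f -> polynomial g -> polynomial (fun x => f x * g x).
Proof.
  intros [l Hl] Hg; revert f Hl; induction l as [|c l IH]; intros f Hf.
  - exists nil; intros; rewrite Hf; simpl; ring.
  - destruct (IH (horner l) (fun _ => eq_refl)) as [h Hh].
    destruct Hg as [m Hm].
    destruct (polynomial_plus (fun x => horner (map (Rmult c) m) x) (horner (0 :: h)))
      as [k Hk]; [eexists; reflexivity..|].
    exists k; intros x; rewrite <- Hk, Hf; simpl.
    assert (E : horner (map (Rmult c) m) x = c * g x).
    { rewrite Hm; clear; induction m as [|d m IH]; simpl; [ring|rewrite IH; ring]. }
    rewrite E, <- Hh; ring.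
Qed.

Lemma polynomial_ext f g : (forall x, f x = g x) -> polynomial f -> polynomial g.
Proof. intros E [l Hl]; exists l; intros x; rewrite <- E; apply Hl. Qed.

Lemma polynomial_opp f : polynomial f -> polynomial (fun x => - f x).
Proof.
  intros H; apply (polynomial_ext (fun x => -1 * f x)); [intros; ring|].
  apply (polynomial_mult (fun _ => -1)); [apply polynomial_const|exact H].
Qed.

Lemma polynomial_minus f g :
  polynomial f -> polynomial g -> polynomial (fun x => f x - g x).
Proof. intros Hf Hg; exact (polynomial_plus _ _ Hf (polynomial_opp _ Hg)). Qed.

Ltac poly :=
  repeat first
    [ assumption
    | lazymatch goal with
      | |- polynomial (fun x => x) => apply polynomial_id
      | |- polynomial (fun x => @?f x * @?g x) => apply (polynomial_mult f g)
      | |- polynomial (fun x => @?f x + @?g x) => apply (polynomial_plus f g)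
      | |- polynomial (fun x => @?f x - @?g x) => apply (polynomial_minus f g)
      | |- polynomial (fun _ => ?c) => apply polynomial_const
      end ].

Lemma horner_continuous l x : continuous (horner l) x.
Proof.
  induction l as [|c l IH]; simpl; [apply continuous_const|].
  apply (continuous_plus (fun _ => c) (fun x => x * horner l x)); [apply continuous_const|].
  apply (continuous_mult (fun x => x) (horner l)); [apply continuous_id|exact IH].
Qed.

(** The constant coefficient is the value at 0; divide by the variable and
    repeat. *)
Lemma polynomial_eq0 f :
  polynomial f -> locally 0 (fun x => f x = 0) -> forall x, f x = 0.
Proof.
  intros [l Hl] H0 x; rewrite Hl.
  assert (H : locally 0 (fun x => horner l x = 0)).
  { revert H0; apply filter_imp; intros y; now rewrite Hl. }
  clear - H; revert x; induction l as [|c l IH]; intros x; [easy|]; simpl in *.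
  assert (Hc : c = 0).
  { apply locally_singleton in H; lra. }
  subst c; rewrite (IH).
  - ring.
  - (* away from 0 divide by the variable; at 0 use continuity *)
    assert (Hn : locally' 0 (fun y => horner l y = 0)).
    { destruct H as [e He]; exists e; intros y Hy Hy0.
      specialize (He y Hy); simpl in He.
      assert (E : y * horner l y = 0) by lra.
      apply Rmult_integral in E; tauto. }
    assert (H0 : horner l 0 = 0).
    { assert (L1 : is_lim (horner l) 0 (horner l 0)).
      { apply is_lim_continuity, continuity_pt_filterlim, horner_continuous. }
      assert (L2 : is_lim (horner l) 0 0).
      { apply (is_lim_ext_loc (fun _ => 0)); [|apply is_lim_const].
        revert Hn; apply filter_imp; intros; symmetry; assumption. }
      apply is_lim_unique in L1; apply is_lim_unique in L2.
      rewrite L1 in L2; now injection L2. }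
    destruct Hn as [e He]; exists e; intros y Hy.
    destruct (Req_dec y 0) as [->|N]; [exact H0|now apply He].
Qed.

Lemma double_atan q :
  cos (2 * atan q) * (1 + q * q) = 1 - q * q /\ sin (2 * atan q) * (1 + q * q) = 2 * q.
Proof.
  rewrite cos_2a, sin_2a, sin_atan, cos_atan; unfold Rsqr.
  assert (Hw : 0 < sqrt (1 + q * q)) by (apply sqrt_lt_R0; nra).
  assert (E : 1 + q * q = sqrt (1 + q * q) * sqrt (1 + q * q)) by (symmetry; apply sqrt_sqrt; nra).
  set (w := sqrt (1 + q * q)) in *; rewrite E; split; field; lra.
Qed.

Lemma cos_shift v q :
  cos (v + 2 * atan q) * (1 + q * q) = cos v * (1 - q * q) - sin v * (2 * q).
Proof.
  destruct (double_atan q) as [C S]; rewrite cos_plus, <- C, <- S; ring.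
Qed.

Lemma sin_shift v q :
  sin (v + 2 * atan q) * (1 + q * q) = sin v * (1 - q * q) + cos v * (2 * q).
Proof.
  destruct (double_atan q) as [C S]; rewrite sin_plus, <- C, <- S; ring.
Qed.

(** The zeros in q of cos v (1 - q^2) - 2 q sin v, the numerator of
    cos (v + 2 atan q), are (- sin v + 1) / cos v and (- sin v - 1) / cos v. *)
Lemma cos_zero_reached v :
  cos v <> 0 -> cos (v + 2 * atan ((1 - sin v) / cos v)) = 0.
Proof.
  intros Hc; set (q := (1 - sin v) / cos v).
  assert (Z : cos (v + 2 * atan q) * (1 + q * q) = 0).
  { rewrite cos_shift; pose proof (sin2_cos2 v) as E; unfold Rsqr in E.
    transitivity ((cos v * cos v - (1 - sin v) * (1 + sin v)) / cos v);
      [unfold q; field; exact Hc|].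
    replace (cos v * cos v - (1 - sin v) * (1 + sin v)) with 0 by lra.
    unfold Rdiv; ring. }
  apply Rmult_integral in Z; destruct Z as [Z|Z]; [exact Z|nra].
Qed.

Lemma cos0_sin2 v : cos v = 0 -> sin v * sin v = 1.
Proof. intros H; pose proof (sin2_cos2 v) as E; rewrite H in E; unfold Rsqr in E; lra. Qed.

Lemma der_inv_cos_pow m v :
  cos v <> 0 -> is_derive (fun t => / cos t ^ m) v (INR m * sin v / cos v ^ S m).
Proof.
  intros Hc; induction m as [|m IH].
  - apply (is_derive_ext (fun _ => / 1)); [reflexivity|].
    der; simpl; field; exact Hc.
  - apply (is_derive_ext (fun t => / cos t * / cos t ^ m)).
    + intros t; simpl; rewrite Rinv_mult; reflexivity.
    + assert (H : is_derive (fun t => / cos t) v (sin v / cos v ^ 2)).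
      { eapply der_eq; [apply der_inv; [apply der_cos|exact Hc]|].
        simpl; field; exact Hc. }
      der; rewrite S_INR; simpl; field; split; [now apply pow_nonzero|exact Hc].
Qed.

(** * The Laplacian of the tube near cos = 0 *)

Definition partials (U : R -> R -> Prop) (f f1 f2 : R -> R -> R) : Prop :=
  forall u v, U u v ->
    is_derive (fun s => f s v) u (f1 u v) /\ is_derive (fun t => f u t) v (f2 u v).

(** Openness along the coordinate lines is all that partial derivatives need,
    and all that the continuation argument needs. *)
Definition line_open (U : R -> R -> Prop) : Prop :=
  forall u v, U u v -> locally u (fun s => U s v) /\ locally v (fun t => U u t).

Lemma partials_ext U f g f1 f2 :
  line_open U -> (forall u v, U u v -> f u v = g u v) ->
  partials U f f1 f2 -> partials U g f1 f2.
Proof.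
  intros HU E H u v Huv; destruct (HU u v Huv) as [L1 L2]; destruct (H u v Huv) as [H1 H2].
  split.
  - apply (is_derive_ext_loc (fun s => f s v)); [|exact H1].
    revert L1; apply filter_imp; intros; now apply E.
  - apply (is_derive_ext_loc (fun t => f u t)); [|exact H2].
    revert L2; apply filter_imp; intros; now apply E.
Qed.

Lemma partials_unique U f f1 f2 g1 g2 u v :
  partials U f f1 f2 -> partials U f g1 g2 -> U u v -> f1 u v = g1 u v /\ f2 u v = g2 u v.
Proof.
  intros Hf Hg Huv; destruct (Hf u v Huv) as [A1 A2]; destruct (Hg u v Huv) as [B1 B2].
  apply is_derive_unique in A1, A2, B1, B2; split; congruence.
Qed.

Lemma partials_lin U c d f f1 f2 g g1 g2 :
  partials U f f1 f2 -> partials U g g1 g2 ->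
  partials U (fun u v => c * f u v + d * g u v)
    (fun u v => c * f1 u v + d * g1 u v) (fun u v => c * f2 u v + d * g2 u v).
Proof.
  intros Hf Hg u v Huv; destruct (Hf u v Huv) as [A1 A2]; destruct (Hg u v Huv) as [B1 B2].
  split; der; ring.
Qed.

Section Tube.
Context (a b r : R) (k tau : R -> R).

Definition delta (u v : R) : R := 1 - r * k u * cos v.
Definition mu (u v : R) : R := k u * delta u v.
(** det II = - r beta on the tube. *)
Definition beta (u v : R) : R := mu u v * cos v.
Definition mu_u (u v : R) : R := Derive k u * (1 - 2 * r * k u * cos v).
Definition beta_u (u v : R) : R := mu_u u v * cos v.
Definition beta_v (u v : R) : R := k u * (2 * r * k u * cos v - 1) * sin v.
Definition Dbeta (u v : R) : R := beta_u u v - tau u * beta_v u v.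

(** The Laplacian of f in terms of E = f_u - tau f_v, its partials E1, E2, and
    f_v, f_vv. The point of E is that the entries of index 11 and 12 of the inverse of II are both multiples of 1 / beta,
    in the ratio 1 : - tau, so that as a
    quadratic form the inverse of II takes the value f_v^2 / r - E^2 / beta at df. *)
Definition lap_expr (E E1 E2 f2 f22 u v : R) : R :=
  (E1 - tau u * E2) / beta u v - / 2 * Dbeta u v / beta u v ^ 2 * E
  - / r * (f22 + / 2 * beta_v u v / beta u v * f2).

(** A relation, not an operator: partial derivatives are supplied as functions,
    so that linearity and extensionality require no differentiability side
    conditions. *)
Definition is_lap (U : R -> R -> Prop) (f g : R -> R -> R) : Prop :=
  exists f1 f2 E1 E2 f21 f22 : R -> R -> R,
    partials U f f1 f2 /\
    partials U (fun u v => f1 u v - tau u * f2 u v) E1 E2 /\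
    partials U f2 f21 f22 /\
    forall u v, U u v ->
      g u v = lap_expr (f1 u v - tau u * f2 u v) (E1 u v) (E2 u v) (f2 u v) (f22 u v) u v.

Lemma is_lap_ext U f f' g g' :
  line_open U -> (forall u v, U u v -> f u v = f' u v) ->
  (forall u v, U u v -> g u v = g' u v) -> is_lap U f g -> is_lap U f' g'.
Proof.
  intros HU Ef Eg (f1 & f2 & E1 & E2 & f21 & f22 & H1 & H2 & H3 & H4).
  exists f1, f2, E1, E2, f21, f22; split; [now apply (partials_ext U f)|].
  split; [exact H2|split; [exact H3|]].
  intros u v Huv; rewrite <- Eg; auto.
Qed.

Lemma is_lap_lin U c d f f' g g' :
  line_open U -> is_lap U f f' -> is_lap U g g' ->
  is_lap U (fun u v => c * f u v + d * g u v) (fun u v => c * f' u v + d * g' u v).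
Proof.
  intros HU (f1 & f2 & E1 & E2 & f21 & f22 & H1 & H2 & H3 & H4)
    (g1 & g2 & F1 & F2 & g21 & g22 & K1 & K2 & K3 & K4).
  do 6 eexists; split; [exact (partials_lin _ c d _ _ _ _ _ _ H1 K1)|].
  split.
  - eapply partials_ext; [exact HU| |exact (partials_lin _ c d _ _ _ _ _ _ H2 K2)].
    intros; simpl; ring.
  - split; [exact (partials_lin _ c d _ _ _ _ _ _ H3 K3)|].
    intros u v Huv; rewrite H4, K4 by assumption; unfold lap_expr, Rdiv; ring.
Qed.

Lemma is_lap_unique U f g g' :
  line_open U -> is_lap U f g -> is_lap U f g' -> forall u v, U u v -> g u v = g' u v.
Proof.
  intros HU (f1 & f2 & E1 & E2 & f21 & f22 & H1 & H2 & H3 & H4)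
    (g1 & g2 & F1 & F2 & g21 & g22 & K1 & K2 & K3 & K4) u v Huv.
  assert (Q : forall u v, U u v -> f1 u v = g1 u v /\ f2 u v = g2 u v).
  { intros; now apply (partials_unique U f). }
  assert (K2' : partials U (fun u v => f1 u v - tau u * f2 u v) F1 F2).
  { eapply partials_ext; [exact HU| |exact K2].
    intros x y Hxy; simpl; destruct (Q x y Hxy) as [-> ->]; reflexivity. }
  assert (K3' : partials U f2 g21 g22).
  { eapply partials_ext; [exact HU| |exact K3].
    intros x y Hxy; symmetry; apply (Q x y Hxy). }
  rewrite H4, K4 by assumption.
  destruct (Q u v Huv) as [<- <-].
  destruct (partials_unique _ _ _ _ _ _ u v H2 K2' Huv) as [<- <-].
  destruct (partials_unique _ _ _ _ _ _ u v H3 K3' Huv) as [_ <-].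
  reflexivity.
Qed.

(** Functions that extend smoothly across cos = 0: the inverse of [delta] is
    admitted because [delta] has no zero, the inverse of cos is not. *)
Inductive regular : (R -> R -> R) -> Prop :=
| regular_coef g : smooth a b g -> regular (fun u _ => g u)
| regular_cos : regular (fun _ v => cos v)
| regular_sin : regular (fun _ v => sin v)
| regular_idelta : regular (fun u v => / delta u v)
| regular_plus F G : regular F -> regular G -> regular (fun u v => F u v + G u v)
| regular_mult F G : regular F -> regular G -> regular (fun u v => F u v * G u v)
| regular_ext F G : (forall u v, F u v = G u v) -> regular F -> regular G.

Lemma regular_const c : regular (fun _ _ => c).
Proof. exact (regular_coef _ (smooth_const a b c)). Qed.

Lemma regular_opp F : regular F -> regular (fun u v => - F u v).
Proof.
  intros H; apply (regular_ext (fun u v => -1 * F u v)); [intros; ring|].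
  apply (regular_mult (fun _ _ => -1)); [apply regular_const|exact H].
Qed.

Lemma regular_minus F G : regular F -> regular G -> regular (fun u v => F u v - G u v).
Proof. intros HF HG; exact (regular_plus _ _ HF (regular_opp _ HG)). Qed.

Lemma regular_pow F n : regular F -> regular (fun u v => F u v ^ n).
Proof.
  intros H; induction n as [|n IH]; simpl; [apply regular_const|now apply regular_mult].
Qed.

Context (Hk : smooth a b k) (Htau : smooth a b tau) (Hr0 : 0 < r)
  (Hkpos : forall u, a < u < b -> 0 < k u)
  (Hrk : forall u, a < u < b -> r * k u < 1).

Definition strip (u v : R) : Prop := a < u < b.

(** Bounded below by 1 - r kappa. *)
Lemma delta_pos u v : a < u < b -> 0 < delta u v.
Proof.
  intros Hu; unfold delta; pose proof (Hkpos u Hu); pose proof (Hrk u Hu).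
  pose proof (COS_bound v); assert (0 < r * k u) by now apply Rmult_lt_0_compat.
  nra.
Qed.

Ltac prove_regular :=
  repeat first
    [ eassumption
    | match goal with
      | |- regular (fun u v => @?f u v / @?g u v) => apply (regular_mult f (fun u v => / g u v))
      | |- regular (fun u v => @?f u v * @?g u v) => apply (regular_mult f g)
      | |- regular (fun u v => @?f u v + @?g u v) => apply (regular_plus f g)
      | |- regular (fun u v => @?f u v - @?g u v) => apply (regular_minus f g)
      | |- regular (fun u v => - @?f u v) => apply (regular_opp f)
      | |- regular (fun u v => @?f u v ^ ?n) => apply (regular_pow f n)
      | |- regular (fun _ v => cos v) => apply regular_cos
      | |- regular (fun _ v => sin v) => apply regular_sin
      | |- regular (fun u v => / delta _ _) => apply regular_idelta
      end
    | apply regular_const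
    | apply regular_coef; auto using smooth_Derive ].

Lemma regular_partials F :
  regular F -> exists F1 F2, regular F1 /\ regular F2 /\ partials strip F F1 F2.
Proof.
  induction 1 as [g Hg| | | |F G _ (F1 & F2 & HF1 & HF2 & PF) _ (G1 & G2 & HG1 & HG2 & PG)
    |F G HF (F1 & F2 & HF1 & HF2 & PF) HG (G1 & G2 & HG1 & HG2 & PG)
    |F G E HF (F1 & F2 & HF1 & HF2 & PF)].
  - exists (fun u _ => Derive g u), (fun _ _ => 0); split; [|split]; [prove_regular..|].
    intros u v Hu; split; [now apply (smooth_is_derive a b)|apply der_const].
  - exists (fun _ _ => 0), (fun _ v => - sin v); split; [|split]; [prove_regular..|].
    intros u v Hu; split; der; reflexivity.
  - exists (fun _ _ => 0), (fun _ v => cos v); split; [|split]; [prove_regular..|].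
    intros u v Hu; split; der; reflexivity.
  - exists (fun u v => r * Derive k u * cos v * (/ delta u v * / delta u v)),
      (fun u v => - (r * k u * sin v) * (/ delta u v * / delta u v)).
    split; [|split]; [prove_regular..|].
    intros u v Hu; pose proof (delta_pos u v Hu).
    pose proof (smooth_is_derive a b k u Hk Hu).
    split; (eapply der_eq; [apply der_inv; [unfold delta; repeat der1|lra]|]);
      simpl; field; lra.
  - exists (fun u v => F1 u v + G1 u v), (fun u v => F2 u v + G2 u v).
    split; [|split]; [prove_regular..|].
    intros u v Hu; destruct (PF u v Hu), (PG u v Hu); split; der; reflexivity.
  - exists (fun u v => F1 u v * G u v + F u v * G1 u v),
      (fun u v => F2 u v * G u v + F u v * G2 u v).
    split; [|split]; [prove_regular..|].
    intros u v Hu; destruct (PF u v Hu), (PG u v Hu); split; der; reflexivity.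
  - exists F1, F2; split; [|split]; [assumption..|].
    intros u v Hu; destruct (PF u v Hu); split.
    + now apply (is_derive_ext (fun s => F s v)).
    + now apply (is_derive_ext (fun t => F u t)).
Qed.

(** A fraction in q whose denominator never vanishes. For the inverse of
    [delta] this holds because its denominator is [delta] times 1 + q^2. *)
Lemma regular_halfangle F u v :
  regular F -> a < u < b ->
  exists P Q, polynomial P /\ polynomial Q /\ (forall q, Q q <> 0) /\
    forall q, F u (v + 2 * atan q) * Q q = P q.
Proof.
  intros HF Hu.
  assert (Hq : forall q, 1 + q * q <> 0) by (intros; nra).
  induction HF as [g Hg| | | |F G _ (P1 & Q1 & HP1 & HQ1 & N1 & E1) _ (P2 & Q2 & HP2 & HQ2 & N2 & E2)
    |F G _ (P1 & Q1 & HP1 & HQ1 & N1 & E1) _ (P2 & Q2 & HP2 & HQ2 & N2 & E2)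
    |F G E HF (P1 & Q1 & HP1 & HQ1 & N1 & E1)].
  - exists (fun _ => g u), (fun _ => 1); split; [poly|]; split; [poly|]; split; intros; lra.
  - exists (fun q => cos v * (1 - q * q) - sin v * (2 * q)), (fun q => 1 + q * q).
    split; [poly|]; split; [poly|]; split; [exact Hq|]; intros; apply cos_shift.
  - exists (fun q => sin v * (1 - q * q) + cos v * (2 * q)), (fun q => 1 + q * q).
    split; [poly|]; split; [poly|]; split; [exact Hq|]; intros; apply sin_shift.
  - assert (E : forall q, delta u (v + 2 * atan q) * (1 + q * q) =
      (1 + q * q) - r * k u * (cos v * (1 - q * q) - sin v * (2 * q))).
    { intros q; rewrite <- (cos_shift v q); unfold delta; ring. }
    exists (fun q => 1 + q * q),
      (fun q => (1 + q * q) - r * k u * (cos v * (1 - q * q) - sin v * (2 * q))).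
    split; [poly|]; split; [poly|]; split; intros q; rewrite <- E;
      pose proof (delta_pos u (v + 2 * atan q) Hu).
    + apply Rmult_integral_contrapositive_currified; [lra|apply Hq].
    + field; lra.
  - exists (fun q => P1 q * Q2 q + P2 q * Q1 q), (fun q => Q1 q * Q2 q).
    split; [poly|]; split; [poly|]; split; intros q.
    + now apply Rmult_integral_contrapositive_currified.
    + rewrite <- E1, <- E2; ring.
  - exists (fun q => P1 q * P2 q), (fun q => Q1 q * Q2 q).
    split; [poly|]; split; [poly|]; split; intros q.
    + now apply Rmult_integral_contrapositive_currified.
    + rewrite <- E1, <- E2; ring.
  - exists P1, Q1; repeat split; try assumption; intros; rewrite <- E; auto.
Qed.

(** Analytic continuation in the angle, for fixed u. The continuation leaves
    the domain on which the vanishing is known, which is why [regular] is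
    defined on all of R in its second argument. *)
Lemma regular_continuation F u v q :
  regular F -> a < u < b -> locally v (fun t => F u t = 0) -> F u (v + 2 * atan q) = 0.
Proof.
  intros HF Hu H0.
  destruct (regular_halfangle F u v HF Hu) as (P & Q & HP & _ & N & E).
  assert (Z : P q = 0).
  { apply polynomial_eq0; [exact HP|].
    assert (C : continuous (fun q => v + 2 * atan q) 0).
    { apply (ex_derive_continuous (K := R_AbsRing) (V := R_NormedModule)).
      auto_derive; auto. }
    unfold continuous in C; rewrite atan_0, Rmult_0_r, Rplus_0_r in C.
    specialize (C _ H0); unfold filtermap in C.
    revert C; apply filter_imp; intros x Hx; rewrite <- E, Hx; ring. }
  rewrite <- E in Z; apply Rmult_integral in Z; destruct Z as [Z|Z]; [exact Z|].
  now apply N in Z.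
Qed.

Context (U : R -> R -> Prop) (HU : line_open U)
  (HUs : forall u v, U u v -> a < u < b /\ cos v <> 0).

(** Only differentiation in the angle raises the order of the pole. *)
Lemma pole_partials F F1 F2 m :
  partials strip F F1 F2 ->
  partials U (fun u v => F u v / cos v ^ m) (fun u v => F1 u v / cos v ^ m)
    (fun u v => (cos v * F2 u v + INR m * sin v * F u v) / cos v ^ S m).
Proof.
  intros PF u v Huv; destruct (HUs u v Huv) as [Hu Hc]; destruct (PF u v Hu) as [H1 H2].
  pose proof (pow_nonzero _ m Hc); pose proof (der_inv_cos_pow m v Hc).
  unfold Rdiv; split; der; simpl; field; auto.
Qed.

Lemma inv_k_smooth : smooth a b (fun u => / k u).
Proof.
  apply smooth_inv; [|exact Hk]; intros u Hu; pose proof (Hkpos u Hu); lra.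
Qed.

Lemma mu_pos u v : a < u < b -> 0 < mu u v.
Proof. intros Hu; apply Rmult_lt_0_compat; [now apply Hkpos|now apply delta_pos]. Qed.

Lemma regular_imu : regular (fun u v => / mu u v).
Proof.
  apply (regular_ext (fun u v => / k u * / delta u v)).
  - intros u v; unfold mu; now rewrite Rinv_mult.
  - apply regular_mult; [exact (regular_coef _ inv_k_smooth)|apply regular_idelta].
Qed.

Lemma regular_beta_u : regular beta_u.
Proof. unfold beta_u, mu_u; prove_regular. Qed.

Lemma regular_beta_v : regular beta_v.
Proof. unfold beta_v; prove_regular. Qed.

Lemma regular_Dbeta : regular Dbeta.
Proof. pose proof regular_beta_u; pose proof regular_beta_v; unfold Dbeta; prove_regular. Qed.

Lemma at_pole u v : cos v = 0 ->
  mu u v = k u /\ beta_v u v = - k u * sin v /\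
  Dbeta u v = tau u * k u * sin v.
Proof.
  intros H; unfold Dbeta, beta_u, beta_v, mu, delta; rewrite H; repeat split; ring.
Qed.

(** Three more orders of pole: one from each of the two applications of
    d/du - tau d/dphi, one from 1 / beta. The factor p (p + 3/2) is p (p + 1),
    from the second derivative, plus p / 2, from the derivative of beta. *)
Lemma is_lap_twist F m : regular F ->
  exists G, regular G /\
    is_lap U (fun u v => F u v / cos v ^ S m) (fun u v => G u v / cos v ^ (m + 4)) /\
    forall u v, a < u < b -> cos v = 0 ->
      G u v = tau u ^ 2 / k u * (INR (S m) * (INR (S m) + 3 / 2)) * F u v.
Proof.
  intros HF.
  destruct (regular_partials F HF) as (Fu & Fv & HFu & HFv & PF).
  pose (p := INR (S m)).
  (* numerators, over cos^(m+2), of f_u - tau f_v and of f_v *)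
  pose (E := fun u v => cos v * (Fu u v - tau u * Fv u v) - p * tau u * sin v * F u v).
  pose (L := fun u v => cos v * Fv u v + p * sin v * F u v).
  assert (HE : regular E) by (unfold E; prove_regular).
  assert (HL : regular L) by (unfold L; prove_regular).
  destruct (regular_partials E HE) as (Eu & Ev & HEu & HEv & PE).
  destruct (regular_partials L HL) as (Lu & Lv & HLu & HLv & PL).
  pose proof regular_imu; pose proof regular_Dbeta; pose proof regular_beta_v.
  exists (fun u v =>
    / mu u v * (cos v * (Eu u v - tau u * Ev u v) - (p + 1) * tau u * sin v * E u v
                - / 2 * (Dbeta u v * / mu u v) * E u v)
    - / r * (cos v * (cos v * Lv u v + (p + 1) * sin v * L u v
                + / 2 * (beta_v u v * / mu u v) * L u v))).
  split; [prove_regular|]; split.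
  - do 6 eexists; split; [apply pole_partials; exact PF|]; split; [|split].
    + eapply partials_ext; [exact HU| |apply (pole_partials E _ _ (S (S m)) PE)].
      intros u v Huv; destruct (HUs u v Huv) as [Hu Hc].
      pose proof (pow_nonzero _ m Hc).
      unfold E, p; simpl pow; field; auto.
    + exact (pole_partials L _ _ (S (S m)) PL).
    + intros u v Huv; destruct (HUs u v Huv) as [Hu Hc]; cbv beta.
      pose proof (pow_nonzero _ m Hc); pose proof (mu_pos u v Hu).
      replace (Fu u v / cos v ^ S m -
        tau u * ((cos v * Fv u v + INR (S m) * sin v * F u v) / cos v ^ S (S m)))
        with (E u v / cos v ^ S (S m)) by (unfold E, p; simpl pow; field; auto).
      change (cos v * Fv u v + INR (S m) * sin v * F u v) with (L u v).
      rewrite (S_INR (S m)); fold p; unfold lap_expr, beta.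
      rewrite pow_add; simpl pow.
      generalize dependent (cos v ^ m); intros c Hcm.
      field; repeat split; lra.
  - intros u v Hu Hc; destruct (at_pole u v Hc) as (-> & -> & ->).
    pose proof (Hkpos u Hu); pose proof (cos0_sin2 v Hc) as S2.
    unfold E, L; rewrite Hc.
    transitivity (tau u ^ 2 / k u * (p * (p + 3 / 2)) * F u v * (sin v * sin v));
      [field; lra|rewrite S2; unfold p; ring].
Qed.

(** Without torsion E = f_u has no larger pole than f, and the part in the angle
    dominates: the second derivative contributes p (p + 1), the derivative of
    beta contributes - p / 2. *)
Lemma is_lap_untwisted F m : (forall u v, U u v -> tau u = 0) -> regular F ->
  exists G, regular G /\
    is_lap U (fun u v => F u v / cos v ^ S m) (fun u v => G u v / cos v ^ (m + 3)) /\
    forall u v, a < u < b -> cos v = 0 ->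
      G u v = - / r * (INR (S m) * (INR (S m) + 1 / 2)) * F u v.
Proof.
  intros T0 HF.
  destruct (regular_partials F HF) as (Fu & Fv & HFu & HFv & PF).
  pose (p := INR (S m)).
  (* numerator of f_v over cos^(m+2) *)
  pose (L := fun u v => cos v * Fv u v + p * sin v * F u v).
  assert (HL : regular L) by (unfold L; prove_regular).
  destruct (regular_partials Fu HFu) as (Fuu & Fuv & HFuu & HFuv & PFu).
  destruct (regular_partials L HL) as (Lu & Lv & HLu & HLv & PL).
  pose proof regular_imu; pose proof regular_beta_v.
  exists (fun u v =>
    / mu u v * cos v * (Fuu u v - / 2 * (mu_u u v * / mu u v) * Fu u v)
    - / r * (cos v * Lv u v + (p + 1) * sin v * L u v
                + / 2 * (beta_v u v * / mu u v) * L u v)).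
  split; [unfold mu_u; prove_regular|]; split.
  - do 6 eexists; split; [apply pole_partials; exact PF|]; split; [|split].
    + eapply partials_ext; [exact HU| |apply (pole_partials Fu _ _ (S m) PFu)].
      intros u v Huv; rewrite (T0 u v Huv); ring.
    + exact (pole_partials L _ _ (S (S m)) PL).
    + intros u v Huv; destruct (HUs u v Huv) as [Hu Hc]; cbv beta.
      pose proof (pow_nonzero _ m Hc); pose proof (mu_pos u v Hu).
      change (cos v * Fv u v + INR (S m) * sin v * F u v) with (L u v).
      rewrite (S_INR (S m)); fold p; unfold lap_expr, Dbeta, beta, beta_u.
      rewrite (T0 u v Huv), pow_add; simpl pow.
      generalize dependent (cos v ^ m); intros c Hcm.
      field; repeat split; lra.
  - intros u v Hu Hc; destruct (at_pole u v Hc) as (-> & -> & _).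
    pose proof (Hkpos u Hu); pose proof (cos0_sin2 v Hc) as S2.
    unfold L; rewrite Hc.
    transitivity (- / r * (p * (p + 1 / 2)) * F u v * (sin v * sin v));
      [field; lra|rewrite S2; unfold p; ring].
Qed.

(** T, H, B are the functions of u obtained from one fixed coordinate of the
    Frenet frame. The general pole estimate does not apply to n, which has no
    pole; here - cos v H - sin v B is the coordinate of n, and its E is
    kappa cos v T by the Frenet equations. *)
Lemma is_lap_gauss T H B : smooth a b T -> smooth a b H -> smooth a b B ->
  (forall u, a < u < b -> is_derive T u (k u * H u)) ->
  (forall u, a < u < b -> is_derive H u (- k u * T u + tau u * B u)) ->
  (forall u, a < u < b -> is_derive B u (- tau u * H u)) ->
  exists F, regular F /\
    is_lap U (fun u v => - cos v * H u - sin v * B u) (fun u v => F u v / cos v ^ 1) /\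
    forall u v, a < u < b -> cos v = 0 ->
      F u v = / 2 * (tau u * sin v * T u + / r * H u).
Proof.
  intros ST SH SB FT FH FB.
  pose proof regular_imu; pose proof regular_Dbeta; pose proof regular_beta_v.
  (* in the second term one factor cos of beta^2 cancels against E = k cos T *)
  exists (fun u v =>
    / mu u v * (cos v * (Derive k u * T u + k u * k u * H u) + tau u * k u * sin v * T u)
    - / 2 * (Dbeta u v * / mu u v * / mu u v) * k u * T u
    - / r * (cos v * (cos v * H u + sin v * B u)
             + / 2 * (beta_v u v * / mu u v) * (sin v * H u - cos v * B u))).
  split; [prove_regular|]; split.
  - exists (fun u v => - cos v * (- k u * T u + tau u * B u) - sin v * (- tau u * H u)),
      (fun u v => sin v * H u - cos v * B u),
      (fun u v => cos v * (Derive k u * T u + k u * k u * H u)),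
      (fun u v => - sin v * k u * T u),
      (fun u v => sin v * (- k u * T u + tau u * B u) - cos v * (- tau u * H u)),
      (fun u v => cos v * H u + sin v * B u).
    split; [|split; [|split]].
    + intros u v Huv; destruct (HUs u v Huv) as [Hu Hc].
      pose proof (FH u Hu); pose proof (FB u Hu); split; der; ring.
    + eapply (partials_ext _ (fun u v => cos v * k u * T u)); [exact HU|intros; ring|].
      intros u v Huv; destruct (HUs u v Huv) as [Hu Hc].
      pose proof (FT u Hu); pose proof (smooth_is_derive a b k u Hk Hu); split; der; ring.
    + intros u v Huv; destruct (HUs u v Huv) as [Hu Hc].
      pose proof (FH u Hu); pose proof (FB u Hu); split; der; ring.
    + intros u v Huv; destruct (HUs u v Huv) as [Hu Hc].
      pose proof (mu_pos u v Hu); unfold lap_expr, beta; field; repeat split; lra.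
  - intros u v Hu Hc; destruct (at_pole u v Hc) as (-> & -> & ->).
    pose proof (Hkpos u Hu); pose proof (cos0_sin2 v Hc) as S2.
    rewrite Hc.
    transitivity (/ 2 * (tau u * sin v * T u + / r * H u * (sin v * sin v)));
      [field; lra|rewrite S2; ring].
Qed.

Lemma is_lap_const c : is_lap U (fun _ _ => c) (fun _ _ => 0).
Proof.
  exists (fun _ _ => 0), (fun _ _ => 0), (fun _ _ => 0), (fun _ _ => 0),
    (fun _ _ => 0), (fun _ _ => 0).
  assert (H : forall c, partials U (fun _ _ => c) (fun _ _ => 0) (fun _ _ => 0)).
  { intros d u v _; split; apply der_const. }
  split; [apply H|]; split; [|split; [apply H|]].
  - apply (partials_ext _ (fun _ _ => 0)); [exact HU|intros; ring|apply H].
  - intros u v _; unfold lap_expr, Rdiv; ring.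
Qed.

Lemma is_lap_eigensum n (c lam : nat -> R) (g : nat -> R -> R -> R) :
  (forall i, (1 <= i <= n)%nat -> is_lap U (g i) (fun u v => lam i * g i u v)) ->
  is_lap U (fun u v => sum_n_m (fun i => c i * g i u v) 1 n)
    (fun u v => sum_n_m (fun i => c i * lam i * g i u v) 1 n).
Proof.
  induction n as [|n IH]; intros Hg.
  - apply (is_lap_ext U (fun _ _ => 0) _ (fun _ _ => 0)); [exact HU| | |apply is_lap_const];
      intros; rewrite sum_n_m_zero by lia; reflexivity.
  - assert (IHn := IH ltac:(intros; apply Hg; lia)).
    assert (L := is_lap_lin U 1 (c (S n)) _ _ _ _ HU IHn (Hg (S n) ltac:(lia))).
    revert L; apply is_lap_ext; [exact HU|..];
      intros u v _; rewrite sum_n_Sm by lia; unfold plus; simpl; ring.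
Qed.

(** v1 is meant to be a zero of the cosine, where the coefficient F u0 v1 of the
    pole of f is read off even if (u0, v1) is outside U. *)
Definition pole_at (u0 v1 : R) (f : R -> R -> R) : Prop :=
  exists m F, regular F /\ F u0 v1 <> 0 /\
    forall u v, U u v -> f u v = F u v / cos v ^ S m.

Section Pole.
Context (u0 v0 : R) (H0 : U u0 v0)
  (Hdich : tau u0 <> 0 \/ forall u v, U u v -> tau u = 0).
Let v1 := v0 + 2 * atan ((1 - sin v0) / cos v0).

(** Otherwise F u0 would vanish near v0, hence at v1 by continuation. *)
Lemma pole_at_nonzero f : pole_at u0 v1 f -> ~ forall u v, U u v -> f u v = 0.
Proof.
  intros (m & F & HF & N & E) Z; apply N.
  apply regular_continuation; [exact HF|apply (HUs u0 v0 H0)|].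
  destruct (HU u0 v0 H0) as [_ L]; revert L; apply filter_imp; intros t Ht.
  destruct (HUs u0 t Ht) as [_ Hc].
  specialize (E u0 t Ht); rewrite (Z u0 t Ht) in E.
  apply (Rmult_eq_reg_r (/ cos t ^ S m)); [|now apply Rinv_neq_0_compat, pow_nonzero].
  rewrite Rmult_0_l; symmetry; exact E.
Qed.

(** The pole of the Laplacian has larger order than that of f, so subtracting a
    multiple of f does not change its leading coefficient. *)
Lemma pole_at_lap f : pole_at u0 v1 f ->
  exists g, is_lap U f g /\ forall l, pole_at u0 v1 (fun u v => 1 * g u v + - l * f u v).
Proof.
  intros (m & F & HF & N & E).
  destruct (HUs u0 v0 H0) as [Hu0 Hc0].
  pose proof (cos_zero_reached v0 Hc0) as Hc1; fold v1 in Hc1.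
  assert (Hp : 0 < INR (S m)) by (apply lt_0_INR; lia).
  pose proof (Hkpos u0 Hu0) as Hk0.
  assert (K : exists n G, regular G /\ G u0 v1 <> 0 /\
    is_lap U (fun u v => F u v / cos v ^ S m) (fun u v => G u v / cos v ^ (S m + S n))).
  { destruct Hdich as [T|T].
    - destruct (is_lap_twist F m HF) as (G & HG & HL & HE).
      exists 2%nat, G; split; [exact HG|]; split;
        [|now replace (S m + 3)%nat with (m + 4)%nat by lia].
      rewrite HE by assumption.
      pose proof (Rinv_0_lt_compat _ Hk0).
      unfold Rdiv; repeat apply Rmult_integral_contrapositive_currified;
        try assumption; try lra; apply pow_nonzero; exact T.
    - destruct (is_lap_untwisted F m T HF) as (G & HG & HL & HE).
      exists 1%nat, G; split; [exact HG|]; split;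
        [|now replace (S m + 2)%nat with (m + 3)%nat by lia].
      rewrite HE by assumption.
      pose proof (Rinv_0_lt_compat _ Hr0).
      repeat apply Rmult_integral_contrapositive_currified; try assumption; lra. }
  destruct K as (n & G & HG & NG & HL).
  exists (fun u v => G u v / cos v ^ (S m + S n)); split.
  - eapply is_lap_ext; [exact HU| |reflexivity|exact HL].
    intros u v Huv; symmetry; now apply E.
  - intros l; exists (m + S n)%nat, (fun u v => G u v + - l * (cos v ^ S n * F u v)).
    split; [prove_regular|]; split.
    + rewrite Hc1; simpl; rewrite !Rmult_0_l, Rmult_0_r, Rplus_0_r; exact NG.
    + intros u v Huv; destruct (HUs u v Huv) as [_ Hc].
      rewrite E by exact Huv; change (S (m + S n)) with (S m + S n)%nat; rewrite pow_add.
      pose proof (pow_nonzero _ (S m) Hc); pose proof (pow_nonzero _ (S n) Hc).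
      field; auto.
Qed.

(** Each step replaces the coefficients c_i by c_i (lambda_i - lambda_n), which
    removes the last eigenfunction. *)
Lemma pole_at_not_eigensum n (lam : nat -> R) (g : nat -> R -> R -> R) :
  (forall i, (1 <= i <= n)%nat -> is_lap U (g i) (fun u v => lam i * g i u v)) ->
  forall (c : nat -> R) f, pole_at u0 v1 f ->
  ~ forall u v, U u v -> f u v = sum_n_m (fun i => c i * g i u v) 1 n.
Proof.
  induction n as [|n IH]; intros Hg c f Hf E.
  - apply (pole_at_nonzero f Hf); intros u v Huv; rewrite E by exact Huv.
    rewrite sum_n_m_zero by lia; reflexivity.
  - destruct (pole_at_lap f Hf) as (h & HL & HP).
    apply (IH ltac:(intros; apply Hg; lia) (fun i => c i * (lam i - lam (S n)))
      _ (HP (lam (S n)))).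
    intros u v Huv.
    assert (Eh : h u v = sum_n_m (fun i => c i * lam i * g i u v) 1 (S n)).
    { revert u v Huv; apply (is_lap_unique U f); [exact HU|exact HL|].
      eapply is_lap_ext; [exact HU| |reflexivity|exact (is_lap_eigensum _ c lam g Hg)].
      intros u v Huv; symmetry; now apply E. }
    rewrite Eh, E by exact Huv.
    rewrite !sum_n_Sm by lia; unfold plus; simpl.
    assert (Q : forall m, sum_n_m (fun i => c i * (lam i - lam (S n)) * g i u v) 1 m =
      sum_n_m (fun i => c i * lam i * g i u v) 1 m
      - lam (S n) * sum_n_m (fun i => c i * g i u v) 1 m).
    { induction m as [|m IHm].
      - rewrite !sum_n_m_zero by lia; unfold zero; simpl; ring.
      - rewrite !sum_n_Sm by lia; rewrite IHm; unfold plus; simpl; ring. }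
    rewrite Q; ring.
Qed.

End Pole.

(** The point (u0, v1) is chosen before the coordinate, so that the conclusion
    may be combined over the three coordinates. Either the torsion is nonzero at
    some u0 met by U, or it vanishes on U; one of the two pole estimates
    applies. *)
Lemma gauss_component_eigensum : (exists u v, U u v) ->
  exists u0 v1, a < u0 < b /\
  forall T H B n0 n (lam : nat -> R) (g : nat -> R -> R -> R),
    smooth a b T -> smooth a b H -> smooth a b B ->
    (forall u, a < u < b -> is_derive T u (k u * H u)) ->
    (forall u, a < u < b -> is_derive H u (- k u * T u + tau u * B u)) ->
    (forall u, a < u < b -> is_derive B u (- tau u * H u)) ->
    (forall i, (1 <= i <= n)%nat -> is_lap U (g i) (fun u v => lam i * g i u v)) ->
    (forall u v, U u v ->
       - cos v * H u - sin v * B u = n0 + sum_n_m (fun i => g i u v) 1 n) ->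
    tau u0 * sin v1 * T u0 + / r * H u0 = 0.
Proof.
  intros Hne.
  assert (K : exists u0 v0, U u0 v0 /\
    (tau u0 <> 0 \/ forall u v, U u v -> tau u = 0)).
  { destruct (classic (exists u v, U u v /\ tau u <> 0)) as [(u & v & Huv & Ht)|N].
    - exists u, v; auto.
    - destruct Hne as (u & v & Huv); exists u, v; split; [exact Huv|right].
      intros x y Hxy; apply NNPP; intros Ht; apply N; now exists x, y. }
  destruct K as (u0 & v0 & H0 & Hd); destruct (HUs u0 v0 H0) as [Hu0 Hc0].
  exists u0, (v0 + 2 * atan ((1 - sin v0) / cos v0)); split; [exact Hu0|].
  intros T H B n0 n lam g ST SH SB FT FH FB Hg E.
  destruct (is_lap_gauss T H B ST SH SB FT FH FB) as (F & HF & HL & EF).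
  specialize (EF _ _ Hu0 (cos_zero_reached v0 Hc0)).
  apply NNPP; intros NZ.
  apply (pole_at_not_eigensum u0 v0 H0 Hd n lam g Hg lam (fun u v => F u v / cos v ^ 1)).
  - exists 0%nat, F; split; [exact HF|]; split; [rewrite EF; lra|reflexivity].
  - apply (is_lap_unique U (fun u v => - cos v * H u - sin v * B u));
      [exact HU|exact HL|].
    assert (L := is_lap_lin U 1 1 _ _ _ _ HU (is_lap_const n0)
               (is_lap_eigensum n (fun _ => 1) lam g Hg)).
    revert L; apply is_lap_ext; [exact HU|..].
    + intros u v Huv; cbv beta; rewrite E by exact Huv.
      rewrite !Rmult_1_l; f_equal; apply sum_n_m_ext; intros; apply Rmult_1_l.
    + intros u v Huv; cbv beta; rewrite Rmult_0_r, Rplus_0_l, Rmult_1_l.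
      apply sum_n_m_ext; intros; rewrite Rmult_1_l; reflexivity.
Qed.

(** * Comparison with the second Beltrami operator *)

Lemma beta_partials : partials strip beta beta_u beta_v.
Proof.
  intros u v Hu; pose proof (smooth_is_derive a b k u Hk Hu).
  unfold beta, mu, delta, beta_u, beta_v, mu_u; split; der; ring.
Qed.

Lemma beta_neq0 u v : a < u < b -> cos v <> 0 -> beta u v <> 0.
Proof.
  intros Hu Hc; apply Rmult_integral_contrapositive_currified; [|exact Hc].
  pose proof (mu_pos u v Hu); lra.
Qed.

(** The logarithmic derivative of the square root of |r y| is y' / (2 y), whatever
    the sign of y. *)
Lemma der_sqrt_abs (y : R -> R) (x l : R) :
  is_derive y x l -> y x <> 0 ->
  is_derive (fun s => sqrt (Rabs (r * y s))) x (/ 2 * sqrt (Rabs (r * y x)) * l / y x).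
Proof.
  intros Hy N.
  assert (N2 : r * y x <> 0) by (apply Rmult_integral_contrapositive_currified; lra).
  assert (P : 0 < Rabs (r * y x)) by now apply Rabs_pos_lt.
  pose proof (sqrt_lt_R0 _ P) as Q.
  eapply der_eq.
  - apply is_derive_sqrt; [|exact P].
    apply is_derive_Rabs; [|exact N2].
    exact (is_derive_scal y x r l Hy).
  - assert (S : Rabs (r * y x) = sign (r * y x) * (r * y x)).
    { destruct (Rdichotomy _ _ N2).
      - rewrite Rabs_left, sign_eq_m1 by lra; ring.
      - rewrite Rabs_right, sign_eq_1 by lra; ring. }
    assert (S2 : sqrt (Rabs (r * y x)) * sqrt (Rabs (r * y x)) = Rabs (r * y x))
      by (apply sqrt_sqrt; lra).
    set (w := sqrt (Rabs (r * y x))) in *.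
    transitivity (sign (r * y x) * (r * y x) * l / (2 * w * y x));
      [field; lra|].
    rewrite <- S, <- S2; field; lra.
Qed.

Lemma DeltaII_of_is_lap (x n : R -> R -> E3) f g :
  (forall u v, a < u < b -> b11 x n u v = r * tau u ^ 2 - beta u v) ->
  (forall u v, a < u < b -> b12 x n u v = r * tau u) ->
  (forall u v, a < u < b -> b22 x n u v = r) ->
  is_lap U f g -> forall u v, U u v -> DeltaII x n f u v = g u v.
Proof.
  intros B11 B12 B22 (f1 & f2 & E1 & E2 & f21 & f22 & Hf & HE & Hf2 & Hg) u v Huv.
  pose (w := fun s t => sqrt (Rabs (r * beta s t))).
  assert (Det : forall s t, a < s < b -> detII x n s t = - (r * beta s t)).
  { intros s t Hs; unfold detII; rewrite B11, B12, B22 by exact Hs; ring. }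
  assert (W : forall s t, a < s < b -> wII x n s t = w s t).
  { intros s t Hs; unfold wII, w; rewrite Det by exact Hs; now rewrite Rabs_Ropp. }
  (* the two components of the vector field under the divergence *)
  assert (V1 : forall s t, U s t ->
    w s t * / beta s t * (-1 * (f1 s t - tau s * f2 s t)) =
    wII x n s t * (ib11 x n s t * Defs.d1 f s t + ib12 x n s t * Defs.d2 f s t)).
  { intros s t Hst; destruct (HUs s t Hst) as [Hs Hc]; destruct (Hf s t Hst) as [F1 F2].
    rewrite (is_derive_unique _ _ _ F1 : Defs.d1 f s t = _).
    rewrite (is_derive_unique _ _ _ F2 : Defs.d2 f s t = _), W by exact Hs.
    unfold ib11, ib12; rewrite Det, B12, B22 by exact Hs.
    pose proof (beta_neq0 s t Hs Hc); field; lra. }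
  assert (V2 : forall s t, U s t ->
    w s t * / beta s t * (tau s * (f1 s t - tau s * f2 s t)) + w s t * (/ r * f2 s t) =
    wII x n s t * (ib12 x n s t * Defs.d1 f s t + ib22 x n s t * Defs.d2 f s t)).
  { intros s t Hst; destruct (HUs s t Hst) as [Hs Hc]; destruct (Hf s t Hst) as [F1 F2].
    rewrite (is_derive_unique _ _ _ F1 : Defs.d1 f s t = _).
    rewrite (is_derive_unique _ _ _ F2 : Defs.d2 f s t = _), W by exact Hs.
    unfold ib12, ib22; rewrite Det, B12, B11 by exact Hs.
    pose proof (beta_neq0 s t Hs Hc); field; lra. }
  destruct (HU u v Huv) as [L1 L2]; destruct (HUs u v Huv) as [Hu Hc].
  pose proof (beta_neq0 u v Hu Hc) as Nb.
  destruct (beta_partials u v Hu) as [Bu Bv].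
  destruct (HE u v Huv) as [HE1 HE2]; destruct (Hf2 u v Huv) as [_ Hf22].
  pose proof (der_sqrt_abs _ _ _ Bu Nb) as Wu; pose proof (der_inv _ _ _ Bu Nb) as Iu.
  pose proof (der_sqrt_abs _ _ _ Bv Nb) as Wv; pose proof (der_inv _ _ _ Bv Nb) as Iv.
  assert (Pw : 0 < w u v).
  { apply sqrt_lt_R0, Rabs_pos_lt, Rmult_integral_contrapositive_currified; lra. }
  assert (R1 : Defs.d1 (fun s t => wII x n s t *
      (ib11 x n s t * Defs.d1 f s t + ib12 x n s t * Defs.d2 f s t)) u v =
    - (w u v / beta u v) *
      (E1 u v - / 2 * beta_u u v / beta u v * (f1 u v - tau u * f2 u v))).
  { apply is_derive_unique.
    apply (is_derive_ext_loc
      (fun s => w s v * / beta s v * (-1 * (f1 s v - tau s * f2 s v))));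
      [revert L1; apply filter_imp; intros s Hs; exact (V1 s v Hs)|].
    eapply der_eq.
    - unfold w; apply der_mult; [apply der_mult; eassumption|].
      apply der_mult; [apply der_const|exact HE1].
    - cbv beta; fold (w u v); field; exact Nb. }
  assert (R2 : Defs.d2 (fun s t => wII x n s t *
      (ib12 x n s t * Defs.d1 f s t + ib22 x n s t * Defs.d2 f s t)) u v =
    tau u * (w u v / beta u v) *
      (E2 u v - / 2 * beta_v u v / beta u v * (f1 u v - tau u * f2 u v))
    + w u v / r * (f22 u v + / 2 * beta_v u v / beta u v * f2 u v)).
  { apply is_derive_unique.
    apply (is_derive_ext_loc (fun t =>
      w u t * / beta u t * (tau u * (f1 u t - tau u * f2 u t)) + w u t * (/ r * f2 u t)));
      [revert L2; apply filter_imp; intros t Ht; exact (V2 u t Ht)|].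
    eapply der_eq.
    - unfold w; apply der_plus; apply der_mult; try eassumption.
      + apply der_mult; eassumption.
      + apply der_mult; [apply der_const|exact HE2].
      + apply der_mult; [apply der_const|exact Hf22].
    - cbv beta; fold (w u v); field; split; (exact Nb || lra). }
  unfold DeltaII; rewrite R1, R2, Hg, W by assumption.
  unfold lap_expr, Dbeta; field; repeat split; lra.
Qed.

Lemma is_lap_of_ex_diff f :
  (forall u v, U u v -> ex_diff_n f 2 u v) -> exists g, is_lap U f g.
Proof.
  intros Hd.
  pose (E := fun u v => Defs.d1 f u v - tau u * Defs.d2 f u v).
  exists (fun u v => lap_expr (E u v) (Defs.d1 E u v) (Defs.d2 E u v) (Defs.d2 f u v) (Defs.d2 (Defs.d2 f) u v) u v).
  exists (Defs.d1 f), (Defs.d2 f), (Defs.d1 E), (Defs.d2 E), (Defs.d1 (Defs.d2 f)), (Defs.d2 (Defs.d2 f)).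
  assert (K : forall u v, U u v ->
    (ex_derive (fun s => f s v) u /\ ex_derive (fun t => f u t) v) /\
    (ex_derive (fun s => Defs.d1 f s v) u /\ ex_derive (fun t => Defs.d1 f u t) v) /\
    (ex_derive (fun s => Defs.d2 f s v) u /\ ex_derive (fun t => Defs.d2 f u t) v)).
  { intros u v Huv; specialize (Hd u v Huv); simpl in Hd; unfold Defs.d1, Defs.d2; tauto. }
  assert (HE : forall u v, U u v -> ex_derive (fun s => E s v) u /\ ex_derive (fun t => E u t) v).
  { intros u v Huv; destruct (K u v Huv) as (_ & [A1 A2] & [B1 B2]).
    destruct (HUs u v Huv) as [Hu _].
    pose proof (smooth_is_derive a b tau u Htau Hu) as Ht.
    apply Derive_correct in A1, A2, B1, B2.
    split; eexists; unfold E; repeat der1. }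
  split; [|split; [|split]].
  - intros u v Huv; destruct (K u v Huv) as ([A1 A2] & _ & _).
    split; apply Derive_correct; assumption.
  - intros u v Huv; destruct (HE u v Huv) as [A1 A2].
    split; apply Derive_correct; assumption.
  - intros u v Huv; destruct (K u v Huv) as (_ & _ & [A1 A2]).
    split; apply Derive_correct; assumption.
  - reflexivity.
Qed.

End Tube.

(** * Coordinates and orthonormal frames of E^3 *)

Lemma E3_eq (p q : E3) : px p = px q -> py p = py q -> pz p = pz q -> p = q.
Proof.
  destruct p as [[x y] z]; destruct q as [[x' y'] z']; unfold px, py, pz; simpl.
  now intros -> -> ->.
Qed.

(** Quantifying over the three coordinates turns each vector equation into one
    scalar equation. *)
Definition coordinate (pr : E3 -> R) : Prop := pr = px \/ pr = py \/ pr = pz.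

Ltac coord H := destruct H as [->|[->| ->]].

Lemma coordinate_plus pr p q : coordinate pr -> pr (plus p q) = pr p + pr q.
Proof. intros H; coord H; reflexivity. Qed.

Lemma coordinate_scal pr c (p : E3) : coordinate pr -> pr (scal c p) = c * pr p.
Proof. intros H; coord H; reflexivity. Qed.

Lemma coordinate_Dcurve pr c u :
  coordinate pr -> pr (Dcurve c u) = Derive (fun s => pr (c s)) u.
Proof. intros H; coord H; reflexivity. Qed.

Lemma coordinate_componentwise pr L F u v :
  coordinate pr -> pr (componentwise L F u v) = L (fun s t => pr (F s t)) u v.
Proof. intros H; coord H; reflexivity. Qed.

Lemma coordinate_sum pr (f : nat -> E3) k :
  coordinate pr -> pr (sum_n_m f 1 k) = sum_n_m (fun i => pr (f i)) 1 k.
Proof.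
  intros H; induction k as [|k IH].
  - rewrite !sum_n_m_zero by lia; coord H; reflexivity.
  - rewrite !sum_n_Sm by lia; rewrite coordinate_plus, IH by exact H; reflexivity.
Qed.

(** An orthonormal pair t, h and its cross product span E^3. *)
Lemma frame_expand (t h v : E3) : dot t t = 1 -> dot h h = 1 -> dot t h = 0 ->
  forall pr, coordinate pr ->
  pr v = dot v t * pr t + dot v h * pr h + dot v (cross t h) * pr (cross t h).
Proof.
  intros Htt Hhh Hth pr Hpr.
  (* |t x h|^2 v = (v.N)N + N x (v x N) for N = t x h *)
  transitivity (pr v * (dot t t * dot h h - dot t h ^ 2)); [rewrite Htt, Hhh, Hth; ring|].
  transitivity (dot v (cross t h) * pr (cross t h)
    + dot v h * (pr h * dot t t - pr t * dot t h)
    - dot v t * (pr h * dot t h - pr t * dot h h)); [|rewrite Htt, Hhh, Hth; ring].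
  destruct t as [[t1 t2] t3]; destruct h as [[h1 h2] h3]; destruct v as [[v1 v2] v3].
  coord Hpr; unfold dot, cross, px, py, pz; simpl; ring.
Qed.

Definition comb (t h b : E3) (x y z : R) : E3 := plus (scal x t) (plus (scal y h) (scal z b)).

Lemma coordinate_comb pr t h b x y z :
  coordinate pr -> pr (comb t h b x y z) = x * pr t + y * pr h + z * pr b.
Proof.
  intros H; unfold comb; rewrite !coordinate_plus, !coordinate_scal by exact H; ring.
Qed.

(** (t, h, t x h) is orthonormal, by Lagrange's identity
    |t x h|^2 = |t|^2 |h|^2 - (t.h)^2. *)
Lemma dot_comb t h x y z x' y' z' : dot t t = 1 -> dot h h = 1 -> dot t h = 0 ->
  dot (comb t h (cross t h) x y z) (comb t h (cross t h) x' y' z') = x * x' + y * y' + z * z'.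
Proof.
  intros Htt Hhh Hth.
  transitivity (x * x' * dot t t + y * y' * dot h h + (x * y' + y * x') * dot t h
    + z * z' * (dot t t * dot h h - dot t h ^ 2)); [|rewrite Htt, Hhh, Hth; ring].
  unfold dot at 1; rewrite !coordinate_comb by (unfold coordinate; auto).
  unfold dot, cross, px, py, pz; simpl; ring.
Qed.

Lemma enorm_eq1 p : enorm p = 1 -> dot p p = 1.
Proof.
  unfold enorm; intros H; rewrite <- (sqrt_sqrt (dot p p)), H; [ring|].
  unfold dot; nra.
Qed.

Lemma unit_circle x y : x * x + y * y = 1 -> exists phi, cos phi = x /\ sin phi = y.
Proof.
  intros H; assert (Hx : -1 <= x <= 1) by nra.
  assert (E : sqrt (1 - x * x) = Rabs y).
  { rewrite <- (sqrt_Rsqr_abs y); f_equal; unfold Rsqr; lra. }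
  destruct (Rle_dec 0 y) as [P|P].
  - exists (acos x); rewrite cos_acos, sin_acos by exact Hx; unfold Rsqr; rewrite E.
    split; [reflexivity|apply Rabs_right; lra].
  - exists (- acos x); rewrite cos_neg, sin_neg, cos_acos, sin_acos by exact Hx.
    unfold Rsqr; rewrite E; split; [reflexivity|rewrite Rabs_left by lra; ring].
Qed.

(** * The Frenet frame and the second fundamental form of the tube *)

Section Frenet.
Context (a b r : R) (rho : R -> E3).
Context (Hsmooth : smooth_curve_on a b rho)
  (Hunit : forall u, a < u < b -> enorm (tangent rho u) = 1)
  (Hcurv : forall u, a < u < b -> curvature rho u <> 0)
  (Hr0 : 0 < r).

Notation T := (tangent rho).
Notation H := (pnormal rho).
Notation B := (binormal rho).
Notation k := (curvature rho).

Definition torsion (u : R) : R := dot (Dcurve H u) (B u).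
Notation tau := torsion.

Lemma rho_smooth pr : coordinate pr -> smooth a b (fun u => pr (rho u)).
Proof.
  intros Hpr; apply smooth_of_ex_derive_n; intros n u Hu.
  destruct (Hsmooth n u Hu) as (X & Y & Z); coord Hpr; assumption.
Qed.

Lemma Dcurve_smooth c pr : coordinate pr ->
  smooth a b (fun u => pr (c u)) -> smooth a b (fun u => pr (Dcurve c u)).
Proof.
  intros Hpr Hc; apply (smooth_ext a b (Derive (fun u => pr (c u)))).
  - intros u _; symmetry; now apply coordinate_Dcurve.
  - now apply smooth_Derive.
Qed.

Lemma T_smooth pr : coordinate pr -> smooth a b (fun u => pr (T u)).
Proof. intros Hpr; now apply Dcurve_smooth, rho_smooth. Qed.

Let cx : coordinate px := or_introl eq_refl.
Let cy : coordinate py := or_intror (or_introl eq_refl).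
Let cz : coordinate pz := or_intror (or_intror eq_refl).

Lemma dot_smooth c d :
  (forall pr, coordinate pr -> smooth a b (fun u => pr (c u))) ->
  (forall pr, coordinate pr -> smooth a b (fun u => pr (d u))) ->
  smooth a b (fun u => dot (c u) (d u)).
Proof.
  intros Hc Hd; unfold dot; repeat apply smooth_plus; apply smooth_mult; auto.
Qed.

Lemma k_pos u : a < u < b -> 0 < k u.
Proof.
  intros Hu; specialize (Hcurv u Hu); unfold curvature, enorm in *.
  pose proof (sqrt_pos (dot (Dcurve T u) (Dcurve T u))); lra.
Qed.

Lemma k_smooth : smooth a b k.
Proof.
  unfold curvature, enorm; apply smooth_sqrt.
  - intros u Hu; pose proof (k_pos u Hu) as P; unfold curvature, enorm in P.
    apply Rnot_le_lt; intros N; rewrite sqrt_neg_0 in P; lra.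
  - apply dot_smooth; intros pr Hpr; now apply Dcurve_smooth, T_smooth.
Qed.

Lemma H_smooth pr : coordinate pr -> smooth a b (fun u => pr (H u)).
Proof.
  intros Hpr; apply (smooth_ext a b (fun u => / k u * pr (Dcurve T u))).
  - intros u Hu; unfold pnormal; now rewrite coordinate_scal.
  - apply smooth_mult; [apply smooth_inv; [exact Hcurv|exact k_smooth]|].
    now apply Dcurve_smooth, T_smooth.
Qed.

Lemma B_smooth pr : coordinate pr -> smooth a b (fun u => pr (B u)).
Proof.
  intros Hpr; coord Hpr;
    [ change (smooth a b (fun s => py (T s) * pz (H s) - pz (T s) * py (H s)))
    | change (smooth a b (fun s => pz (T s) * px (H s) - px (T s) * pz (H s)))
    | change (smooth a b (fun s => px (T s) * py (H s) - py (T s) * px (H s))) ];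
    apply smooth_minus; apply smooth_mult; auto using T_smooth, H_smooth.
Qed.

Lemma tau_smooth : smooth a b tau.
Proof.
  apply dot_smooth; intros pr Hpr; [now apply Dcurve_smooth, H_smooth|now apply B_smooth].
Qed.

Lemma coordinate_derive c pr u : coordinate pr ->
  smooth a b (fun u => pr (c u)) -> a < u < b ->
  is_derive (fun s => pr (c s)) u (pr (Dcurve c u)).
Proof.
  intros Hpr Hc Hu; rewrite coordinate_Dcurve by exact Hpr.
  exact (smooth_is_derive a b _ u Hc Hu).
Qed.

Lemma dot_derive c d u :
  (forall pr, coordinate pr -> smooth a b (fun u => pr (c u))) ->
  (forall pr, coordinate pr -> smooth a b (fun u => pr (d u))) -> a < u < b ->
  is_derive (fun s => dot (c s) (d s)) u (dot (Dcurve c u) (d u) + dot (c u) (Dcurve d u)).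
Proof.
  intros Hc Hd Hu.
  pose proof (coordinate_derive c px u cx (Hc _ cx) Hu).
  pose proof (coordinate_derive c py u cy (Hc _ cy) Hu).
  pose proof (coordinate_derive c pz u cz (Hc _ cz) Hu).
  pose proof (coordinate_derive d px u cx (Hd _ cx) Hu).
  pose proof (coordinate_derive d py u cy (Hd _ cy) Hu).
  pose proof (coordinate_derive d pz u cz (Hd _ cz) Hu).
  unfold dot; der; ring.
Qed.

Lemma dot_derive_const c d m u :
  (forall pr, coordinate pr -> smooth a b (fun u => pr (c u))) ->
  (forall pr, coordinate pr -> smooth a b (fun u => pr (d u))) ->
  (forall u, a < u < b -> dot (c u) (d u) = m) -> a < u < b ->
  dot (Dcurve c u) (d u) + dot (c u) (Dcurve d u) = 0.
Proof.
  intros Hc Hd E Hu.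
  rewrite <- (is_derive_unique _ _ _ (dot_derive c d u Hc Hd Hu)).
  apply is_derive_unique, (is_derive_ext_loc (fun _ => m)); [|apply der_const].
  generalize (between_locally a b u Hu); apply filter_imp; intros s Hs; symmetry; now apply E.
Qed.

Lemma dot_comm p q : dot p q = dot q p.
Proof. unfold dot; ring. Qed.

Lemma dot_scal_r c p q : dot p (scal c q) = c * dot p q.
Proof. unfold dot; rewrite !coordinate_scal by auto; ring. Qed.

Lemma T_unit u : a < u < b -> dot (T u) (T u) = 1.
Proof. intros Hu; now apply enorm_eq1, Hunit. Qed.

Lemma T_H u : a < u < b -> dot (T u) (H u) = 0.
Proof.
  intros Hu; unfold pnormal; rewrite dot_scal_r.
  pose proof (dot_derive_const T T 1 u T_smooth T_smooth T_unit Hu) as E.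
  rewrite (dot_comm (Dcurve T u)) in E.
  replace (dot (T u) (Dcurve T u)) with 0 by lra; ring.
Qed.

Lemma H_unit u : a < u < b -> dot (H u) (H u) = 1.
Proof.
  intros Hu; unfold pnormal; rewrite dot_scal_r, dot_comm, dot_scal_r.
  pose proof (Hcurv u Hu) as N.
  assert (E : dot (Dcurve T u) (Dcurve T u) = k u * k u).
  { unfold curvature, enorm; rewrite sqrt_sqrt; [reflexivity|unfold dot; nra]. }
  rewrite E; field; exact N.
Qed.

Lemma DT_eq pr u : coordinate pr -> a < u < b -> pr (Dcurve T u) = k u * pr (H u).
Proof.
  intros Hpr Hu; unfold pnormal; rewrite coordinate_scal by exact Hpr; field; auto.
Qed.

Lemma T_derive pr u : coordinate pr -> a < u < b ->
  is_derive (fun s => pr (T s)) u (k u * pr (H u)).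
Proof.
  intros Hpr Hu; rewrite <- DT_eq by assumption.
  apply coordinate_derive; auto using T_smooth.
Qed.

(** The components along t and h come from differentiating t.h = 0 and
    h.h = 1; the one along b is the torsion by definition. *)
Lemma DH_eq pr u : coordinate pr -> a < u < b ->
  pr (Dcurve H u) = - k u * pr (T u) + tau u * pr (B u).
Proof.
  intros Hpr Hu.
  rewrite (frame_expand (T u) (H u)) by auto using T_unit, H_unit, T_H.
  fold (B u); fold (tau u).
  pose proof (dot_derive_const H H 1 u H_smooth H_smooth H_unit Hu) as E1.
  pose proof (dot_derive_const T H 0 u T_smooth H_smooth T_H Hu) as E2.
  rewrite (dot_comm (H u)) in E1.
  assert (E3 : dot (Dcurve T u) (H u) = k u * dot (H u) (H u)).
  { unfold dot; rewrite !DT_eq by auto; ring. }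
  rewrite E3, H_unit, (dot_comm (T u)) in E2 by exact Hu.
  replace (dot (Dcurve H u) (H u)) with 0 by lra.
  replace (dot (Dcurve H u) (T u)) with (- k u) by lra; ring.
Qed.

Lemma H_derive pr u : coordinate pr -> a < u < b ->
  is_derive (fun s => pr (H s)) u (- k u * pr (T u) + tau u * pr (B u)).
Proof.
  intros Hpr Hu; rewrite <- DH_eq by assumption.
  apply coordinate_derive; auto using H_smooth.
Qed.

Lemma B_derive pr u : coordinate pr -> a < u < b ->
  is_derive (fun s => pr (B s)) u (- tau u * pr (H u)).
Proof.
  intros Hpr Hu.
  pose proof (T_derive px u cx Hu) as T1; pose proof (T_derive py u cy Hu) as T2;
  pose proof (T_derive pz u cz Hu) as T3; pose proof (H_derive px u cx Hu) as H1;
  pose proof (H_derive py u cy Hu) as H2; pose proof (H_derive pz u cz Hu) as H3.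
  (* b' = tau (t x b), and t x (t x h) = - h *)
  apply (der_eq _ _ (- tau u * (pr (H u) * dot (T u) (T u) - pr (T u) * dot (T u) (H u))));
    [|rewrite T_unit, T_H by exact Hu; ring].
  coord Hpr;
    [ apply (is_derive_ext (fun s => py (T s) * pz (H s) - pz (T s) * py (H s)));
        [reflexivity|]
    | apply (is_derive_ext (fun s => pz (T s) * px (H s) - px (T s) * pz (H s)));
        [reflexivity|]
    | apply (is_derive_ext (fun s => px (T s) * py (H s) - py (T s) * px (H s)));
        [reflexivity|] ];
    der; unfold binormal, cross, dot, px, py, pz; simpl; ring.
Qed.

Notation X := (tube_param rho r).
Notation N := (tube_gauss_map rho).

Lemma coordinate_X pr u v : coordinate pr ->
  pr (X u v) = pr (rho u) + (r * cos v * pr (H u) + r * sin v * pr (B u)).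
Proof.
  intros Hpr; unfold tube_param; now rewrite !coordinate_plus, !coordinate_scal by exact Hpr.
Qed.

Lemma coordinate_N pr u v : coordinate pr ->
  pr (N u v) = - cos v * pr (H u) - sin v * pr (B u).
Proof.
  intros Hpr; unfold tube_gauss_map.
  rewrite !coordinate_plus, !coordinate_scal by exact Hpr; ring.
Qed.

Lemma X_partials pr : coordinate pr ->
  partials (fun u _ => a < u < b) (fun u v => pr (X u v))
    (fun u v => (1 - r * k u * cos v) * pr (T u)
      + r * tau u * (cos v * pr (B u) - sin v * pr (H u)))
    (fun u v => r * (cos v * pr (B u) - sin v * pr (H u))).
Proof.
  intros Hpr u v Hu.
  pose proof (coordinate_derive rho pr u Hpr (rho_smooth pr Hpr) Hu) as D0.
  pose proof (H_derive pr u Hpr Hu) as D1; pose proof (B_derive pr u Hpr Hu) as D2.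
  split.
  - apply (is_derive_ext (fun s => pr (rho s) + (r * cos v * pr (H s) + r * sin v * pr (B s)))).
    + intros s; symmetry; now apply coordinate_X.
    + der; unfold tangent; ring.
  - apply (is_derive_ext (fun t => pr (rho u) + (r * cos t * pr (H u) + r * sin t * pr (B u)))).
    + intros s; symmetry; now apply coordinate_X.
    + der; ring.
Qed.

(** x_u = (1 - r kappa cos) t + tau x_phi is differentiated once more with the
    Frenet equations. *)
Lemma X_u_partials pr : coordinate pr ->
  partials (fun u _ => a < u < b) (fun u v => pr (D1 X u v))
    (fun u v => pr (comb (T u) (H u) (B u)
      (- r * Derive k u * cos v + r * tau u * k u * sin v)
      ((1 - r * k u * cos v) * k u - r * Derive tau u * sin v - r * tau u ^ 2 * cos v)
      (r * Derive tau u * cos v - r * tau u ^ 2 * sin v)))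
    (fun u v => pr (comb (T u) (H u) (B u)
      (r * k u * sin v) (- r * tau u * cos v) (- r * tau u * sin v))).
Proof.
  intros Hpr.
  apply (partials_ext _ (fun u v => (1 - r * k u * cos v) * pr (T u)
      + r * tau u * (cos v * pr (B u) - sin v * pr (H u)))).
  - intros u v Hu; split; [now apply between_locally|].
    apply filter_forall; intros _; exact Hu.
  - intros u v Hu; unfold D1; rewrite coordinate_componentwise by exact Hpr.
    symmetry; apply is_derive_unique; apply (X_partials pr Hpr u v Hu).
  - intros u v Hu.
    pose proof (T_derive pr u Hpr Hu) as D0.
    pose proof (H_derive pr u Hpr Hu) as D1; pose proof (B_derive pr u Hpr Hu) as D2.
    pose proof (smooth_is_derive a b _ u k_smooth Hu) as D3.
    pose proof (smooth_is_derive a b _ u tau_smooth Hu) as D4.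
    rewrite !coordinate_comb by exact Hpr; split; der; ring.
Qed.

Lemma X_uu u v : a < u < b -> D1 (D1 X) u v = comb (T u) (H u) (B u)
  (- r * Derive k u * cos v + r * tau u * k u * sin v)
  ((1 - r * k u * cos v) * k u - r * Derive tau u * sin v - r * tau u ^ 2 * cos v)
  (r * Derive tau u * cos v - r * tau u ^ 2 * sin v).
Proof.
  intros Hu; apply E3_eq; apply is_derive_unique.
  - apply (X_u_partials px cx u v Hu).
  - apply (X_u_partials py cy u v Hu).
  - apply (X_u_partials pz cz u v Hu).
Qed.

Lemma X_uv u v : a < u < b -> D2 (D1 X) u v = comb (T u) (H u) (B u)
  (r * k u * sin v) (- r * tau u * cos v) (- r * tau u * sin v).
Proof.
  intros Hu; apply E3_eq; apply is_derive_unique.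
  - apply (X_u_partials px cx u v Hu).
  - apply (X_u_partials py cy u v Hu).
  - apply (X_u_partials pz cz u v Hu).
Qed.

Lemma X_vv u v : a < u < b -> D2 (D2 X) u v =
  comb (T u) (H u) (B u) 0 (- r * cos v) (- r * sin v).
Proof.
  intros Hu.
  assert (K : forall pr, coordinate pr ->
    pr (D2 (D2 X) u v) = pr (comb (T u) (H u) (B u) 0 (- r * cos v) (- r * sin v)));
    [|apply E3_eq; apply K; auto].
  intros pr Hpr; unfold D2; rewrite coordinate_componentwise by exact Hpr.
  apply is_derive_unique.
  apply (is_derive_ext (fun t => r * (cos t * pr (B u) - sin t * pr (H u)))).
  - intros t; rewrite coordinate_componentwise by exact Hpr.
    symmetry; apply is_derive_unique; apply (X_partials pr Hpr u t Hu).
  - rewrite coordinate_comb by exact Hpr; der; ring.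
Qed.

Lemma dot_comb_N u v x y z : a < u < b ->
  dot (comb (T u) (H u) (B u) x y z) (N u v) = - cos v * y - sin v * z.
Proof.
  intros Hu.
  replace (N u v) with (comb (T u) (H u) (B u) 0 (- cos v) (- sin v)).
  - unfold binormal; rewrite dot_comb by auto using T_unit, H_unit, T_H; ring.
  - apply E3_eq; rewrite coordinate_comb, coordinate_N by auto; ring.
Qed.

Lemma b11_tube u v : a < u < b -> b11 X N u v = r * tau u ^ 2 - beta r k u v.
Proof.
  intros Hu; unfold b11; rewrite X_uu, dot_comb_N by exact Hu.
  transitivity (r * tau u ^ 2 * (Rsqr (sin v) + Rsqr (cos v)) - beta r k u v).
  - unfold Rsqr, beta, mu, delta; ring.
  - rewrite sin2_cos2; ring.
Qed.

Lemma b12_tube u v : a < u < b -> b12 X N u v = r * tau u.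
Proof.
  intros Hu; unfold b12; rewrite X_uv, dot_comb_N by exact Hu.
  transitivity (r * tau u * (Rsqr (sin v) + Rsqr (cos v))); [unfold Rsqr; ring|].
  rewrite sin2_cos2; ring.
Qed.

Lemma b22_tube u v : a < u < b -> b22 X N u v = r.
Proof.
  intros Hu; unfold b22; rewrite X_vv, dot_comb_N by exact Hu.
  transitivity (r * (Rsqr (sin v) + Rsqr (cos v))); [unfold Rsqr; ring|].
  rewrite sin2_cos2; ring.
Qed.

(** det II has the factor cos, and a quotient with numerator 0 is 0. *)
Lemma parabolic_of_cos0 u v : a < u < b -> cos v = 0 -> parabolic X N u v.
Proof.
  intros Hu Hc; unfold parabolic, gauss_curvature, detII.
  rewrite b11_tube, b12_tube, b22_tube by exact Hu; unfold beta; rewrite Hc.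
  unfold Rdiv; ring.
Qed.

Lemma tube_param_in_tube u v : a < u < b -> tube rho a b r (X u v).
Proof.
  intros Hu; exists u, (comb (T u) (H u) (B u) 0 (r * cos v) (r * sin v)).
  assert (E : comb (T u) (H u) (B u) 1 0 0 = T u).
  { apply E3_eq; rewrite coordinate_comb by auto; ring. }
  split; [exact Hu|]; split; [|split].
  - rewrite <- E at 2; unfold binormal.
    rewrite dot_comb by auto using T_unit, H_unit, T_H; ring.
  - unfold enorm, binormal; rewrite dot_comb by auto using T_unit, H_unit, T_H.
    transitivity (sqrt (Rsqr r)); [f_equal|apply sqrt_Rsqr; lra].
    pose proof (sin2_cos2 v) as E2.
    transitivity (Rsqr r * (Rsqr (sin v) + Rsqr (cos v)));
      [unfold Rsqr; ring|rewrite E2; ring].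
  - apply E3_eq; rewrite coordinate_X, coordinate_plus, coordinate_comb by auto; ring.
Qed.

(** A normal vector of length r is r cos v h + r sin v b for some v. *)
Lemma tube_param_onto p : tube rho a b r p -> exists u v, a < u < b /\ X u v = p.
Proof.
  intros (u & w & Hu & Hw & Hn & ->); exists u.
  set (y := dot w (H u)); set (z := dot w (cross (T u) (H u))).
  assert (Ew : w = comb (T u) (H u) (B u) 0 y z).
  { apply E3_eq; rewrite coordinate_comb by auto;
      rewrite (frame_expand (T u) (H u) w) by auto using T_unit, H_unit, T_H;
      rewrite Hw; reflexivity. }
  assert (Eyz : y * y + z * z = r * r).
  { transitivity (dot w w).
    - rewrite Ew; unfold binormal; rewrite dot_comb by auto using T_unit, H_unit, T_H; ring.
    - rewrite <- Hn; unfold enorm; symmetry; apply sqrt_sqrt; unfold dot; nra. }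
  destruct (unit_circle (y / r) (z / r)) as (v & Hc & Hs).
  { transitivity ((y * y + z * z) / (r * r)); [field; lra|rewrite Eyz; field; lra]. }
  exists v; split; [exact Hu|].
  rewrite Ew; apply E3_eq;
    rewrite coordinate_X, coordinate_plus, coordinate_comb, Hc, Hs by auto; field; lra.
Qed.

Lemma continuous_E3 (c : R -> E3) u :
  (forall pr, coordinate pr -> ex_derive (fun s => pr (c s)) u) -> continuous c u.
Proof.
  intros Hc.
  assert (K : forall pr, coordinate pr -> forall eps : posreal,
    locally u (fun s => ball (pr (c u)) eps (pr (c s)))).
  { intros pr Hpr; apply (proj1 (filterlim_locally (fun s => pr (c s)) _)).
    exact (ex_derive_continuous (K := R_AbsRing) (V := R_NormedModule) _ _ (Hc pr Hpr)). }
  apply filterlim_locally; intros eps.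
  generalize (filter_and _ _ (K px cx eps) (filter_and _ _ (K py cy eps) (K pz cz eps))).
  apply filter_imp; intros s (X1 & X2 & X3); repeat split; assumption.
Qed.

(** M is the trace on the tube of an open set O of E^3, and the parametrization
    stays in the tube, so that the domain of M is the inverse image of O. *)
Lemma tube_domain_line_open (M : E3 -> Prop) :
  open_part_of (tube rho a b r) M ->
  line_open (fun u v => tube_domain rho a b r M (u, v)).
Proof.
  intros (O & HO & HM) u v [Hu Hm]; simpl in Hu, Hm.
  apply HM in Hm; destruct Hm as [Hm _].
  assert (Ex : forall pr, coordinate pr ->
    ex_derive (fun s => pr (X s v)) u /\ ex_derive (fun t => pr (X u t)) v).
  { intros pr Hpr; destruct (X_partials pr Hpr u v Hu); split; eexists; eassumption. }
  split.
  - assert (C : continuous (fun s => X s v) u) by (apply continuous_E3; intros; now apply Ex).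
    assert (C' : locally u (fun s => O (X s v))) by exact (C O (HO _ Hm)).
    generalize (filter_and _ _ (between_locally a b u Hu) C'); apply filter_imp; intros s [Hs HOs]; split; [exact Hs|].
    apply HM; split; [exact HOs|now apply tube_param_in_tube].
  - assert (C : continuous (fun t => X u t) v) by (apply continuous_E3; intros; now apply Ex).
    assert (C' : locally v (fun t => O (X u t))) by exact (C O (HO _ Hm)).
    revert C'; apply filter_imp; intros t HOt; split; [exact Hu|].
    apply HM; split; [exact HOt|now apply tube_param_in_tube].
Qed.

End Frenet.

(** * The Gauss map *)

Theorem theorem3 (a b : R) (rho : R -> E3) (r : R) (M : E3 -> Prop)
  (Hab : a < b)
  (Hsmooth : smooth_curve_on a b rho)
  (Hunit : forall u, a < u < b -> enorm (tangent rho u) = 1)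
  (Hemb : top_embedding_on (fun u : R => a < u < b) rho)
  (Hcurv : forall u, a < u < b -> curvature rho u <> 0)
  (Hr0 : 0 < r)
  (Hr : forall u, a < u < b -> r < 1 / Rabs (curvature rho u))
  (Hsurf : smooth_surface (tube rho a b r))
  (HM : open_part_of (tube rho a b r) M)
  (HMne : exists p, M p)
  (HMpar : forall u phi, tube_domain rho a b r M (u, phi) ->
     ~ parabolic (tube_param rho r) (tube_gauss_map rho) u phi) :
  infinite_II_type (tube_param rho r) (tube_gauss_map rho)
    (tube_domain rho a b r M) M.
Proof.
  pose (U := fun u v => tube_domain rho a b r M (u, v)).
  assert (HU : line_open U) by now apply tube_domain_line_open.
  assert (HUs : forall u v, U u v -> a < u < b /\ cos v <> 0).
  { intros u v Huv; assert (Hu : a < u < b) by apply Huv.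
    split; [exact Hu|]; intros Hc; apply (HMpar u v Huv).
    now apply (parabolic_of_cos0 a b). }
  assert (Hkpos : forall u, a < u < b -> 0 < curvature rho u).
  { now apply k_pos. }
  assert (Hrk : forall u, a < u < b -> r * curvature rho u < 1).
  { intros u Hu; specialize (Hr u Hu); specialize (Hkpos u Hu).
    rewrite Rabs_right in Hr by lra.
    apply (Rmult_lt_compat_r _ _ _ Hkpos) in Hr.
    replace (1 / curvature rho u * curvature rho u) with 1 in Hr by (field; lra); exact Hr. }
  assert (Sk : smooth a b (curvature rho)) by now apply k_smooth.
  assert (St : smooth a b (torsion rho)) by now apply tau_smooth.
  assert (Hne : exists u v, U u v).
  { destruct HMne as [p Hp]; pose proof Hp as Hp'.
    destruct HM as (O & _ & HO); apply HO in Hp'; destruct Hp' as [_ Ht].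
    destruct (tube_param_onto a b r rho Hsmooth Hunit Hcurv Hr0 p Ht) as (u & v & Hu & E).
    exists u, v; split; [exact Hu|]; simpl; now rewrite E. }
  intros (n0 & n & nn & lam & Heig & Hsum).
  destruct (gauss_component_eigensum a b r (curvature rho) (torsion rho)
    Sk St Hr0 Hkpos Hrk U HU HUs Hne) as (u0 & v1 & Hu0 & K).
  assert (Z : forall pr, coordinate pr ->
    torsion rho u0 * sin v1 * pr (tangent rho u0) + / r * pr (pnormal rho u0) = 0).
  { intros pr Hpr.
    apply (K (fun u => pr (tangent rho u)) (fun u => pr (pnormal rho u))
      (fun u => pr (binormal rho u)) (pr n0) n lam
      (fun i u v => pr (nn i (tube_param rho r u v)))).
    - now apply T_smooth.
    - now apply H_smooth.
    - now apply B_smooth.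
    - intros u Hu; now apply (T_derive a b).
    - intros u Hu; now apply (H_derive a b).
    - intros u Hu; now apply (B_derive a b).
    - intros i Hi; destruct (Heig i Hi) as (_ & Hs & He).
      destruct (is_lap_of_ex_diff a b r (curvature rho) (torsion rho) St U HUs
        (fun u v => pr (nn i (tube_param rho r u v)))) as [g Hg].
      { intros u v Huv; destruct (Hs 2%nat u v Huv) as (A1 & A2 & A3); coord Hpr; assumption. }
      generalize Hg; apply is_lap_ext; [exact HU|reflexivity|].
      intros u v Huv.
      rewrite <- coordinate_scal, <- He, coordinate_componentwise by assumption.
      symmetry; apply (DeltaII_of_is_lap a b r (curvature rho) (torsion rho) Sk Hr0 Hkpos Hrk
        U HU HUs).
      + now apply b11_tube.
      + now apply b12_tube.
      + now apply b22_tube.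
      + exact Hg.
      + exact Huv.
    - intros u v Huv.
      rewrite <- coordinate_N, Hsum, coordinate_plus, coordinate_sum by assumption.
      reflexivity. }
  (* the vector of the three left-hand sides has inner product 1 / r with h *)
  pose proof (H_unit a b rho Hcurv u0 Hu0) as HH.
  pose proof (T_H a b rho Hsmooth Hunit u0 Hu0) as TH.
  assert (E : torsion rho u0 * sin v1 * dot (tangent rho u0) (pnormal rho u0)
    + / r * dot (pnormal rho u0) (pnormal rho u0) = 0).
  { transitivity
      (px (pnormal rho u0) * (torsion rho u0 * sin v1 * px (tangent rho u0) + / r * px (pnormal rho u0))
       + py (pnormal rho u0) * (torsion rho u0 * sin v1 * py (tangent rho u0) + / r * py (pnormal rho u0))
       + pz (pnormal rho u0) * (torsion rho u0 * sin v1 * pz (tangent rho u0) + / r * pz (pnormal rho u0)));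
      [unfold dot; ring|].
    rewrite !Z by (unfold coordinate; auto); ring. }
  rewrite HH, TH in E; pose proof (Rinv_0_lt_compat r Hr0); lra.
Qed.
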